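(* Let $g:(0,\infty)\to(0,\infty)$ be a function that converges monotonically to zero, and assume that one of the following holds: (a) $g$ varies regularly at infinity with index strictly less than $-2$; or (b') the function $u\mapsto u^2g(u)$ converges monotonically to zero as $u\to\infty$. If $$\lim_{u\to\infty}\frac{\Lambda_g(u)}{\log\log u}=0,$$ then $\mathbb P$-almost surely $\limsup_{n\to\infty}\lambda_1^{(n)}/g(n)=\infty$.
   Context: Let $d\ge 2$. Let $\mathfrak E_d=\{\{x,y\}: x,y\in\mathbb Z^d,\ |x-y|_1=1\}$; write $x\sim y$ if $\{x,y\}\in\mathfrak E_d$. The environment $\boldsymbol w=(w_e)_{e\in\mathfrak E_d}$ is a family of i.i.d. $(0,\infty)$-valued random variables with law $\mathbb P$; $w$ denotes a generic copy. Let $B_n=[-n,n]^d\cap\mathbb Z^d$. For real-valued $f\in\ell^2(\mathbb Z^d)$, $\mathcal E^{\boldsymbol w}(f)=\frac12\sum_{x}\sum_{y\sim x}w_{xy}(f(x)-f(y))^2$ (the Dirichlet form of $(\mathcal L_{\boldsymbol w}f)(x)=\sum_{y\sim x}w_{xy}(f(y)-f(x))$). The principal Dirichlet eigenvalue in $B_n$ is $\lambda_1^{(n)}=\inf\{\mathcal E^{\boldsymbol w}(f): \mathrm{supp}\,f\subseteq B_n,\ \|f\|_2=1\}$. For $g:(0,\infty)\to(0,\infty)$, $\Lambda_g(u)=u^d\,\mathbb P[w\le g(u)]^{2d}$. A function varies regularly at infinity with index $\rho$ if it equals $u^\rho L(u)$ with $L(Cu)/L(u)\to1$ as $u\to\infty$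 for all $C>0$. *)

(* Defs.v *)
From HB Require Import structures.
From mathcomp Require Import all_boot all_order all_algebra.
From mathcomp Require Import all_classical all_reals all_analysis.
Set Implicit Arguments. Unset Strict Implicit. Unset Printing Implicit Defensive.
Import Order.TTheory GRing.Theory Num.Theory numFieldNormedType.Exports.
Local Open Scope classical_set_scope.
Local Open Scope ring_scope.

Definition pt (d : nat) := 'rV[int]_d.

Definition ev (d : nat) (i : 'I_d) : pt d := delta_mx 0 i.

(* Nearest-neighbour edges of Z^d are indexed by (x, i) : pt d * 'I_d,      *)
(* standing for the unordered edge {x, x + e_i}; this is a bijection onto   *)
(* the edge set E_d.                                                        *)
Definition edge (d : nat) := (pt d * 'I_d)%type.

Definition inbox (d n : nat) (x : pt d) : Prop := forall j, `|x 0 j| <= n%:Z.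
Definition boxpt (d n : nat) (k : {ffun 'I_d -> 'I_(2 * n + 1)}) : pt d :=
  \row_j ((k j : nat)%:Z - n%:Z).

Section Env.
Variables (R : realType) (d : nat).

Definition cond (W : edge d -> R) (x y : pt d) : R :=
  if [pick i | y == x + ev i] is Some i then W (x, i) else
  if [pick i | x == y + ev i] is Some i then W (y, i) else 0.

(* Dirichlet form E^w(f) = 1/2 sum_x sum_{y~x} w_xy (f x - f y)^2, for f    *)
(* supported in B_n.  For such f every nonzero term has x in B_{n+1}, so    *)
(* the (a priori infinite) outer sum is written over x in B_{n+1}; the      *)
(* inner sum runs over the 2d neighbours x + e_i and x - e_i.               *)
Definition dirichlet (W : edge d -> R) (n : nat) (f : pt d -> R) : R :=
  2^-1 * \sum_(k : {ffun 'I_d -> 'I_(2 * n.+1 + 1)})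
    \sum_(i < d) \sum_(b : bool)
      (let x := boxpt k in
       let y := if b then x + ev i else x - ev i in
       cond W x y * (f x - f y) ^+ 2).

Definition lambda1 (W : edge d -> R) (n : nat) : R :=
  inf [set dirichlet W n f | f in
        [set f : pt d -> R | (forall x, ~ inbox n x -> f x = 0) /\
           \sum_(k : {ffun 'I_d -> 'I_(2 * n + 1)}) f (boxpt k) ^+ 2 = 1]].

Definition reg_var (g : R -> R) (rho : R) : Prop :=
  let L := fun u => g u * powR u (- rho) in
  forall C : R, 0 < C -> (L (C * u) / L u) @[u --> +oo] --> (1 : R).

Definition mono_to_zero (g : R -> R) : Prop :=
  (forall u v, 0 < u -> u <= v -> g v <= g u) /\ g u @[u --> +oo] --> (0 : R).

End Env.

Definition iid_env (R : realType) (dd : measure_display) (T : measurableType dd)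
    (P : probability T R) (d : nat) (w : edge d -> T -> R) : Prop :=
  [/\ (forall e, measurable_fun setT (w e)),
      (forall e om, 0 < w e om),
      (forall e e' (B : set R), measurable B ->
          P (w e @^-1` B) = P (w e' @^-1` B)) &
      (forall (s : seq (edge d)) (B : edge d -> set R), uniq s ->
          (forall e, measurable (B e)) ->
          P (\bigcap_(e in [set e | e \in s]) (w e @^-1` B e)) =
          (\prod_(e <- s) P (w e @^-1` B e))%E)].

(* Lambda_g(u) = u^d P[w <= g(u)]^{2d}, w a generic copy (edge (0, e_0)) *)
Definition Lambda (R : realType) (dd : measure_display) (T : measurableType dd)
    (P : probability T R) (d : nat) (w : edge d -> T -> R) (i0 : 'I_d)
    (g : R -> R) (u : R) : R :=
  u ^+ d * fine (P [set om | w (0, i0) om <= g u]) ^+ (2 * d).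

(* Main.v *)
Require Import Defs.
From HB Require Import structures.
From mathcomp Require Import all_boot all_order all_algebra.
From mathcomp Require Import all_classical all_reals all_analysis.
From mathcomp Require Import zify ring lra.
Import Order.TTheory GRing.Theory Num.Theory numFieldNormedType.Exports.
Local Open Scope classical_set_scope.
Local Open Scope ring_scope.

(** Fix [C] large and call an edge bad if its conductance is at most [C g(n)].
    Since [u^2 g(u)] is (almost) decreasing, [C g(n) <= g(n / A)] for a constant
    [A], hence [n^d P(bad)^(2d) = o(log log n)].  Consequently a vertex all of
    whose edges are bad is the only way to be cut off: along [n_k = 2^(4 k^2)],
    almost surely eventually no ball of fixed radius contains [2d + 1] bad
    edges, while by Harris' inequality the annulus [B_(n_(k+1)) \ B_(n_k)]
    contains no isolated vertex with probability at least [1 / (k + 1)],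
    independently in [k], so this happens infinitely often.

    At such a scale every vertex [x] reaches, by boundedly many good edges, a
    nearby "hub" [phi x], a vertex lying only on coordinate slices of a ball
    without bad edges.  Neighbouring hubs are joined by edges of conductance at
    least [g(2^j)], where [j] is the first level at which the ball has fewer
    than [m] edges of conductance at most [g(2^j)].  A law of large numbers
    along lines (exponential moments of the number of bad balls) shows that
    these levels are so rarely large that telescoping along lines gives
    [|f|^2 <= (K / (C g(n)) + o(1 / g(n))) E(f)], i.e.
    [lambda_1 >= (C / K') g(n)]. *)

(** * Lattice geometry and a Poincare inequality *)

(** A single threshold cannot work: moving [f] over a distance of order [n] through edges of
    conductance [C g(n)] costs about [n^2 / (C g(n))], too much by [n^2]. Weak edges may be used
    only boundedly often, near each vertex; the long transport runs through conductances of constant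
    order, at cost [n^2 / g(2^j0)], which is [o(1 / g(n))]. Lines do meet poor balls, where the
    level [j] must be raised. Almost monotonicity of [u^2 g(u)] gives
    [1 / g(2^j) <= 4^j / (c n^2 g(n))], so a density [2^(-3j)] of poor balls at level [j] is
    affordable: it leaves [2^(-j)], summable and small for large [j0]. This density comes from a
    large [m]: with [m = 2d(4d+4)], [P(w <= g(2^j))^m] is at most [2^(-(4d+4)j)] for large [j], and
    the same power beats the number of vertices at the top level [2^(k^2)], where the climb stops.
    Hubs are needed because the edges of the line itself may be bad: adjacent hubs are linked
    through clean slices instead. *)

Section Lattice.
Variables (R : realType) (d : nat).
Implicit Types (x y u v : pt d) (i j : 'I_d) (c : int).

Definition set_coord u i c : pt d := \row_j (if j == i then c else u 0 j).

Lemma inbox_boxpt (n : nat) (k : {ffun 'I_d -> 'I_(2 * n + 1)}) : inbox n (boxpt k).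
Proof. by move=> j; rewrite mxE; have := ltn_ord (k j); lia. Qed.

Lemma inboxB (n : nat) u v : inbox n (u - v) <-> forall j, `|u 0 j - v 0 j| <= n%:Z.
Proof. by split=> H j; have := H j; rewrite !mxE. Qed.

Lemma ptD u v j : (u + v) 0 j = (u 0%R j + v 0%R j)%R.
Proof. by rewrite mxE. Qed.

Lemma boxpt_inj (n : nat) : injective (@boxpt d n).
Proof.
move=> k k' /rowP kk'; apply/ffunP => j; apply/val_inj => /=.
by have := kk' j; rewrite !mxE; lia.
Qed.

Lemma inbox_ex (n : nat) x : inbox n x -> exists k, x = @boxpt d n k.
Proof.
move=> xn.
have lt j : (absz (x 0%R j + n%:Z)%R < 2 * n + 1)%N by have := xn j; lia.
exists [ffun j => Ordinal (lt j)]; apply/rowP => j; rewrite mxE ffunE /=.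
by have := xn j; lia.
Qed.

Lemma ev_coord i j : (ev i : pt d) 0 j = (j == i)%:Z.
Proof. by rewrite mxE eqxx; case: eqP. Qed.

Lemma ev_inj : injective (@ev d).
Proof.
move=> i j ij; apply/eqP; have : (ev i : pt d) 0 i = (ev j : pt d) 0 i by rewrite ij.
by rewrite !ev_coord eqxx; case: eqP.
Qed.

Lemma cond_ev (W : edge d -> R) x i : cond W x (x + ev i) = W (x, i).
Proof.
rewrite /cond; case: pickP => [j /eqP/addrI/ev_inj -> //|/(_ i)].
by rewrite eqxx.
Qed.

Lemma cond_ge0 (W : edge d -> R) x y : (forall e, 0 <= W e) -> 0 <= cond W x y.
Proof. by move=> W0; rewrite /cond; do 2?case: pickP. Qed.

Definition df (f : pt d -> R) v i : R := f v - f (v + ev i).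

Definition local_energy (W : edge d -> R) (r : nat) (f : pt d -> R) y : R :=
  \sum_(k : {ffun 'I_d -> 'I_(2 * r + 1)}) \sum_(i < d)
    W (y + boxpt k, i) * df f (y + boxpt k) i ^+ 2.

(** The terms with [b = true] already visit each edge once; the backward terms are nonnegative and
    are dropped, at the price of the factor 2. *)
Lemma dirichlet_ge (W : edge d -> R) (n : nat) (f : pt d -> R) :
  (forall e, 0 <= W e) ->
  local_energy W n.+1 f 0 / 2 <= dirichlet W n f.
Proof.
move=> W0; rewrite mulrC ler_pM2l// /local_energy.
apply: ler_sum => k _; apply: ler_sum => i _.
rewrite big_bool/= cond_ev add0r lerDl mulr_ge0 ?sqr_ge0//.
exact: cond_ge0.
Qed.

Lemma local_energy_ge0 W r f y : (forall e, 0 <= W e) -> 0 <= local_energy W r f y.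
Proof.
by move=> W0; do 2![apply: sumr_ge0 => ? _]; rewrite mulr_ge0 ?sqr_ge0.
Qed.

Lemma df_local_energy (W : edge d -> R) r (f : pt d -> R) y v i (s : R) :
  (forall e, 0 <= W e) -> 0 < s -> s <= W (v, i) -> inbox r (v - y) ->
  `|df f v i| <= Num.sqrt (local_energy W r f y / s).
Proof.
move=> W0 s0 sW /inbox_ex[k vk].
have {vk}vk : v = y + boxpt k by rewrite -vk addrC subrK.
rewrite vk in sW *.
rewrite -sqrtr_sqr ler_sqrt; last first.
  by rewrite divr_ge0 ?local_energy_ge0 // ltW.
rewrite ler_pdivlMr// /local_energy (bigD1 k)//= (bigD1 i)//= -addrA.
rewrite ler_wpDr//.
  apply: addr_ge0; apply: sumr_ge0 => ? _; first by rewrite mulr_ge0 ?sqr_ge0.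
  by apply: sumr_ge0 => ? _; rewrite mulr_ge0 ?sqr_ge0.
by rewrite mulrC ler_wpM2r ?sqr_ge0.
Qed.

Lemma line_move (f : pt d -> R) (tau : R) u i (k : nat) :
  (forall l : nat, (l < k)%N -> `|df f (u + ev i *+ l) i| <= tau) ->
  `|f u - f (u + ev i *+ k)| <= k%:R * tau.
Proof.
elim: k => [_|k IH H]; first by rewrite mulr0n addr0 subrr normr0 mul0r.
have -> : f u - f (u + ev i *+ k.+1) =
    (f u - f (u + ev i *+ k)) + df f (u + ev i *+ k) i.
  by rewrite /df mulrSr addrA; ring.
rewrite mulrSr mulrDl mul1r (le_trans (ler_normD _ _))// lerD//; last exact: H.
by apply: IH => l lk; apply: H; rewrite (leq_trans lk).
Qed.

Lemma set_coord_add u i c : u 0 i <= c ->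
  set_coord u i c = u + ev i *+ absz (c - u 0 i)%R.
Proof.
move=> uc; apply/rowP => j; rewrite !mxE mulmxnE !mxE eqxx/=.
by case: (eqVneq j i) => [->|_] /=; rewrite ?mul0rn ?addr0 //; lia.
Qed.

Lemma set_coord_id u i c : u 0 i = c -> set_coord u i c = u.
Proof. by move=> uc; apply/rowP => j; rewrite mxE; case: eqP => [->|]. Qed.

Lemma set_coordK u i c c' : set_coord (set_coord u i c) i c' = set_coord u i c'.
Proof. by apply/rowP => j; rewrite !mxE; case: eqP. Qed.

Lemma segment_move (f : pt d -> R) (tau : R) u i c :
  (forall v, (forall j, j != i -> v 0 j = u 0 j) ->
     Num.min (u 0 i) c <= v 0 i < Num.max (u 0 i) c -> `|df f v i| <= tau) ->
  `|f u - f (set_coord u i c)| <= (absz (u 0 i - c)%R)%:R * tau.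
Proof.
have key u' c' : u' 0 i <= c' ->
  (forall v, (forall j, j != i -> v 0 j = u' 0 j) ->
     u' 0 i <= v 0 i < c' -> `|df f v i| <= tau) ->
  `|f u' - f (set_coord u' i c')| <= (absz (u' 0 i - c')%R)%:R * tau.
  move=> uc H; rewrite set_coord_add// distnC; apply: line_move => l lk.
  apply: H => [j ji|]; rewrite !mxE mulmxnE !mxE !eqxx/=.
    by rewrite (negbTE ji) mul0rn addr0.
  by lia.
move=> H; case: (leP (u 0 i) c) => uc.
  by apply: key => // v vj vi; apply: H => //; lia.
have := key (set_coord u i c) (u 0 i).
rewrite set_coordK (set_coord_id u i (u 0 i))// !mxE eqxx distnC distrC; apply; first lia.
move=> v vj vi; apply: H; last lia.
by move=> j ji; rewrite vj// mxE (negbTE ji).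
Qed.


(** * Bad edges, clean slices and hubs *)

Definition nbad (r : nat) (beta : edge d -> bool) y : nat :=
  #|[set a : {ffun 'I_d -> 'I_(2 * r + 1)} * 'I_d | beta (y + boxpt a.1, a.2)]%SET|.

(** Only the base vertex of a bad edge is tested, whatever its direction, so each bad edge spoils
    exactly one value of [c]. This is what allows existence of clean slices by pigeonhole. *)
Definition clean (r : nat) (beta : edge d -> bool) y i c : Prop :=
  forall v j, inbox r (v - y) -> beta (v, j) -> v 0 i != c.

Definition bad_coords (r : nat) (beta : edge d -> bool) y i : seq int :=
  [seq (y + boxpt a.1 : pt d) 0 i | a <- enum
     [set a : {ffun 'I_d -> 'I_(2 * r + 1)} * 'I_d | beta (y + boxpt a.1, a.2)]%SET].

Lemma size_bad_coords r beta y i : size (bad_coords r beta y i) = nbad r beta y.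
Proof. by rewrite size_map -cardE. Qed.

Lemma clean_notin r beta y i c : c \notin bad_coords r beta y i -> clean r beta y i c.
Proof.
move=> cn v j /inbox_ex[k vk] bv; apply: contra cn => /eqP <-.
have {}vk : v = y + boxpt k by rewrite -vk addrC subrK.
by apply/mapP; exists (k, j); rewrite ?mem_enum ?inE/= -?vk.
Qed.

Lemma exists_notin (L : seq int) (a : int) (M : nat) : (size L < M)%N ->
  exists c, [/\ a <= c, c < a + M%:Z & c \notin L].
Proof.
move=> LM; apply: contrapT => H.
have sub : {subset [seq a + l%:Z | l <- iota 0 M] <= L}.
  move=> c /mapP[l]; rewrite mem_iota add0n => /andP[_ lM] ->.
  by apply: contrapT => /negP cL; apply: H; exists (a + l%:Z); split=> //; lia.
have un : uniq [seq a + l%:Z | l <- iota 0 M].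
  by rewrite map_inj_uniq ?iota_uniq// => l l' ; lia.
by have := uniq_leq_size un sub; rewrite size_map size_iota leqNgt LM.
Qed.

Lemma exists_clean r beta y i (a : int) (M : nat) : (nbad r beta y < M)%N ->
  exists c, [/\ a <= c, c < a + M%:Z & clean r beta y i c].
Proof.
rewrite -(size_bad_coords r beta y i) => /(exists_notin (bad_coords r beta y i) a)[c [ac ca cn]].
by exists c; split=> //; exact: clean_notin.
Qed.

Lemma exists_clean2 r beta y beta' y' i (a : int) (M : nat) :
  (nbad r beta y + nbad r beta' y' < M)%N ->
  exists c, [/\ a <= c, c < a + M%:Z, clean r beta y i c & clean r beta' y' i c].
Proof.
rewrite -(size_bad_coords r beta y i) -(size_bad_coords r beta' y' i) -size_cat.
move=> /(exists_notin (_ ++ _) a)[c [ac ca]].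
rewrite mem_cat negb_or => /andP[cn cn'].
by exists c; split=> //; exact: clean_notin.
Qed.

Section Hub.
Variables (r : nat) (beta : edge d -> bool) (y : pt d) (f : pt d -> R) (tau : R).
Hypothesis tau0 : 0 <= tau.
Hypothesis good_df : forall v i, inbox r (v - y) -> ~~ beta (v, i) -> `|df f v i| <= tau.

(** The coordinates of [u] are replaced by those of [u'] one at a time. All intermediate points stay
    in the ball and in the clean slice, so only good edges are crossed, at most [2 * r] for each
    coordinate. *)
Lemma slice_move u u' i : inbox r (u - y) -> inbox r (u' - y) ->
  u 0 i = u' 0 i -> clean r beta y i (u 0 i) ->
  `|f u - f u'| <= (d * (2 * r))%:R * tau.
Proof.
move=> ur u'r uu' cl.
pose mix (l : nat) : pt d := \row_j (if (j < l)%N then u' 0 j else u 0 j).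
have mixr l : inbox r (mix l - y).
  by move=> j; have := ur j; have := u'r j; rewrite !mxE; case: ifP.
have mixi l : mix l 0 i = u 0 i by rewrite mxE; case: ifP.
have mix0 : mix 0%N = u by apply/rowP => j; rewrite mxE.
have mixd : mix d = u' by apply/rowP => j; rewrite mxE ltn_ord.
suff H l : (l <= d)%N -> `|f u - f (mix l)| <= (l * (2 * r))%:R * tau.
  by rewrite -mixd; exact: H.
elim: l => [_|l IH ld]; first by rewrite mix0 subrr normr0 mul0n mul0r.
have step : `|f (mix l) - f (mix l.+1)| <= (2 * r)%:R * tau.
  pose j := Ordinal ld.
  have mixS : mix l.+1 = set_coord (mix l) j (u' 0 j).
    apply/rowP => j'; rewrite !mxE.
    case: (eqVneq j' j) => [->|]; first by rewrite leqnn.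
    by rewrite -val_eqE/= ltnS leq_eqVlt => /negbTE ->.
  have [ji|ji] := eqVneq j i.
    by rewrite mixS set_coord_id ?ji ?mixi// subrr normr0 mulr_ge0.
  have /inboxB/(_ j) mj := mixr l; have /inboxB/(_ j) u'j := u'r.
  move: (mix l) (mixi l) mixS (mixr l) mj => q qi -> qr qj.
  rewrite (le_trans (@segment_move _ tau _ _ _ _))//; last first.
    by rewrite ler_wpM2r// ler_nat; lia.
  move=> v vj vb.
  have vr : inbox r (v - y).
    apply/inboxB => j'; have [->|j'j] := eqVneq j' j; first by lia.
    by rewrite vj//; move/inboxB: qr; exact.
  apply: good_df => //; apply/negP => bv.
  by move/eqP: (cl v j vr bv); apply; rewrite vj// eq_sym.
rewrite mulSn natrD mulrDl [X in _ <= X]addrC.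
have -> : f u - f (mix l.+1) = (f u - f (mix l)) + (f (mix l) - f (mix l.+1)) by ring.
by rewrite (le_trans (ler_normD _ _))// lerD// IH// ltnW.
Qed.

Definition hub (x : pt d) : Prop :=
  inbox r (x - y) /\ forall i, clean r beta y i (x 0 i).

(** The path turns at [x] with its [i]-th coordinate replaced by that of [u]. This point lies on the
    slice of [u] in direction [i] and on the slice of the hub in any direction [j != i], which
    exists because [d >= 2]; both slices are clean. *)
Lemma to_hub (x : pt d) u i : (2 <= d)%N -> hub x -> inbox r (u - y) ->
  clean r beta y i (u 0 i) -> `|f u - f x| <= 2 * (d * (2 * r))%:R * tau.
Proof.
move=> d2 [xr xc] ur uc.
have [j ji] : exists j : 'I_d, j != i.
  have d1 : (1 < d)%N by [].
  case: (eqVneq i (Ordinal d1)) => [->|]; last by exists (Ordinal d1); rewrite eq_sym.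
  by exists (Ordinal (ltnW d1)).
pose v := set_coord x i (u 0 i).
have vr : inbox r (v - y).
  apply/inboxB => l; rewrite mxE; case: eqP => [->|_]; first by move/inboxB: ur; exact.
  by move/inboxB: xr; exact.
have H1 : `|f u - f v| <= (d * (2 * r))%:R * tau.
  by apply: (@slice_move u v i) => //; rewrite mxE eqxx.
have H2 : `|f v - f x| <= (d * (2 * r))%:R * tau.
  apply: (@slice_move v x j) => //; first by rewrite mxE (negbTE ji).
  by rewrite mxE (negbTE ji).
have -> : f u - f x = (f u - f v) + (f v - f x) by ring.
by rewrite (le_trans (ler_normD _ _))// -mulrA mulr_natl mulr2n lerD.
Qed.

(* The rays leaving a nearest-neighbour pair are indexed by direction, sign *)
(* and endpoint; this recovers the index of the ray containing an edge.     *)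
Definition ray_index (b : pt d) (a : 'I_d) (e : edge d) : 'I_d * bool * bool :=
  (e.2, b 0 e.2 <= e.1 0 e.2, b 0 a < e.1 0 a).

(** There are [4 d] indices; the two removed ones would run from one endpoint of the pair towards
    the other. The remaining [4 d - 2] exceed [2 d] since [d >= 2], and each bad edge has a single
    index, so some index carries no bad edge. *)
Lemma exists_free_ray (b : pt d) (a : 'I_d) : (2 <= d)%N -> (nbad r beta y <= 2 * d)%N ->
  exists j (s o : bool), [/\ j = a -> s = o &
    forall v, inbox r (v - y) -> ray_index b a (v, j) = (j, s, o) -> ~~ beta (v, j)].
Proof.
move=> d2 nb.
pose bad := [set k : {ffun 'I_d -> 'I_(2 * r + 1)} * 'I_d | beta (y + boxpt k.1, k.2)]%SET.
pose rays := [set: 'I_d * bool * bool] :\: [set (a, true, false); (a, false, true)].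
pose img := [set ray_index b a (y + boxpt k.1, k.2) | k in bad]%SET.
have cimg : (#|img| <= 2 * d)%N by rewrite (leq_trans (leq_imset_card _ _)).
have crays : (2 * d < #|rays|)%N.
  rewrite cardsD cardsT !card_prod card_ord !card_bool finset.setTI cards2.
  by case: eqP => //= _; lia.
have [[[j s] o] jr jn] : exists2 x, x \in rays & x \notin img.
  apply/subsetPn; apply: contraTN crays => /subset_leq_card H.
  by rewrite -leqNgt (leq_trans H).
exists j, s, o; split.
  by move=> ja; move: jr; rewrite !inE ja !xpair_eqE eqxx/= andbT; case: s {jn}; case: o.
move=> v /inbox_ex[k vk] ri; apply: contra jn => bv.
have {}vk : v = y + boxpt k by rewrite -vk addrC subrK.
by apply/imsetP; exists (k, j); rewrite ?inE/= -?vk.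
Qed.

(** The three summands are the costs of the three pieces of the path: crossing the good edge if the
    free ray starts at its other end, following the ray to a clean slice (found within [2 d + 1]
    values, since at most [2 d] are spoiled), and [to_hub]. *)
Lemma attach_hub (x b : pt d) (a : 'I_d) : (2 <= d)%N -> (2 * d + 2 <= r)%N ->
  (nbad r beta y <= 2 * d)%N -> hub x -> y = b \/ y = b + ev a -> ~~ beta (b, a) ->
  `|f y - f x| <= (1 + (2 * d + 1) + 2 * (d * (2 * r)))%:R * tau.
Proof.
move=> d2 dr nb xh yb nba.
have byr : inbox r (b - y).
  apply/inboxB => j; case: yb => ->; first by rewrite subrr.
  by rewrite mxE ev_coord; case: eqP => _ /=; lia.
have [j [sg [en [jso free]]]] := exists_free_ray b a d2 nb.
pose p : pt d := if en then b + ev a else b.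
have pj l : p 0 l = b 0 l + (en && (l == a))%:Z.
  by rewrite /p; case: (en); rewrite ?addr0// mxE ev_coord.
have py l : `|p 0 l - y 0 l| <= 1.
  rewrite pj; case: yb => ->; rewrite ?mxE ?ev_coord; case: (l == a); case: (en) => /=; lia.
have H1 : `|f y - f p| <= tau.
  have := good_df b a byr nba.
  by rewrite /p /df; case: yb => ->; case: (en); rewrite ?subrr ?normr0// distrC.
have [c [c1 c2 cc]] := exists_clean r beta y j
  (if sg then p 0 j else p 0 j - (2 * d + 1)%N%:Z) (2 * d + 1)
  (leq_ltn_trans nb (ltac:(lia) : (2 * d < 2 * d + 1)%N)).
have cr : `|c - y 0 j| <= r%:Z by have := py j; case: (sg) c1 c2; lia.
pose q := set_coord p j c.
have qr : inbox r (q - y).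
  apply/inboxB => l; rewrite mxE; case: eqP => [->//|_].
  by have := py l; lia.
have H2 : `|f p - f q| <= (2 * d + 1)%:R * tau.
  apply: (le_trans (@segment_move _ tau _ _ _ _)); last first.
    by rewrite ler_wpM2r// ler_nat; case: (sg) c1 c2; lia.
  move=> v vl vj.
  have vr : inbox r (v - y).
    apply/inboxB => l; have [->|lj] := eqVneq l j; first by have := py j; lia.
    by rewrite vl//; have := py l; lia.
  apply: good_df => //; apply: free => //; rewrite /ray_index/=.
  have Es : (b 0 j <= v 0 j) = sg.
    have := pj j; case: (eqVneq j a) => [ja|_]; last first.
      by rewrite andbF/=; case: (sg) c1 c2; lia.
    rewrite -(jso ja) andbT; case: (sg) c1 c2 => /=; lia.
  have Eo : (b 0 a < v 0 a) = en.
    case: (eqVneq a j) => [aj|aj].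
      have := pj j; have := jso (esym aj); rewrite aj eqxx andbT => <-.
      by case: (sg) c1 c2 => /=; lia.
    by rewrite vl// pj eqxx andbT; case: (en) => /=; lia.
  by rewrite Es Eo.
have H3 : `|f q - f x| <= 2 * (d * (2 * r))%:R * tau.
  by apply: (@to_hub x q j) => //; rewrite /q mxE eqxx.
have -> : f y - f x = (f y - f p) + (f p - f q) + (f q - f x) by ring.
rewrite (le_trans (ler_normD _ _))// natrD mulrDl lerD//; last by rewrite natrM.
by rewrite (le_trans (ler_normD _ _))// natrD mulrDl mul1r lerD.
Qed.

End Hub.

Lemma exists_hub r beta y (M : nat) : (nbad r beta y < M)%N -> (M <= r)%N -> exists x, hub r beta y x.
Proof.
move=> nM Mr; have /choice[c cP] i := exists_clean r beta y i (y 0 i) M nM.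
exists (\row_i c i); split=> [|i]; last by rewrite mxE; case: (cP i).
by apply/inboxB => j; rewrite mxE; case: (cP j); lia.
Qed.

(** Lets the hub chosen for the higher threshold [Num.max t (Z y)] serve also at threshold [t],
    where vertices are attached to it. *)
Lemma hub_sub r (beta beta' : edge d -> bool) y x : (forall e, beta e -> beta' e) ->
  hub r beta' y x -> hub r beta y x.
Proof. by move=> H [xr xc]; split=> // i v j vr /H; exact: xc. Qed.

(* Neighbouring hubs are compared through a point all of whose coordinates *)
(* are clean for both balls.                                               *)
Lemma hub_step r (beta beta' : edge d -> bool) y y' (f : pt d -> R) (tau tau' : R) x x' (M : nat) :
  (2 <= d)%N -> 0 <= tau -> 0 <= tau' ->
  (forall v i, inbox r (v - y) -> ~~ beta (v, i) -> `|df f v i| <= tau) ->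
  (forall v i, inbox r (v - y') -> ~~ beta' (v, i) -> `|df f v i| <= tau') ->
  (forall j, `|y 0 j - y' 0 j| <= 1) ->
  (nbad r beta y < M)%N -> (nbad r beta' y' < M)%N -> (2 * M + 1 <= r)%N ->
  hub r beta y x -> hub r beta' y' x' ->
  `|f x - f x'| <= 2 * (d * (2 * r))%:R * (tau + tau').
Proof.
move=> d2 t0 t0' H H' yy nM nM' Mr hx hx'.
have nn : (nbad r beta y + nbad r beta' y' < 2 * M)%N by lia.
have /choice[c cP] i := exists_clean2 r beta y beta' y' i (y 0 i) (2 * M) nn.
pose z : pt d := \row_i c i.
have i0 : 'I_d by exact: (Ordinal d2).
have zr : inbox r (z - y) by apply/inboxB => j; rewrite mxE; case: (cP j); lia.
have zr' : inbox r (z - y').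
  by apply/inboxB => j; rewrite mxE; have := yy j; case: (cP j); lia.
have H1 : `|f z - f x| <= 2 * (d * (2 * r))%:R * tau.
  by apply: (@to_hub r beta y f tau t0 H x z i0) => //; rewrite mxE; case: (cP i0).
have H2 : `|f z - f x'| <= 2 * (d * (2 * r))%:R * tau'.
  by apply: (@to_hub r beta' y' f tau' t0' H' x' z i0) => //; rewrite mxE; case: (cP i0).
have -> : f x - f x' = (f x - f z) + (f z - f x') by ring.
by rewrite (le_trans (ler_normD _ _))// mulrDr lerD// distrC.
Qed.

(** * Double counting and the weighted Poincare inequality *)

Lemma sum_fiber_le (K : finType) (psi : K -> pt d) (N F : nat) (h : pt d -> R) :
  (forall v, 0 <= h v) -> (forall v, ~ inbox N v -> h v = 0) ->
  (forall v, (#|[set k | psi k == v]%SET| <= F)%N) ->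
  \sum_k h (psi k) <= F%:R * \sum_(k : {ffun 'I_d -> 'I_(2 * N + 1)}) h (boxpt k).
Proof.
move=> h0 hN hF.
have E k : h (psi k) =
    \sum_(l : {ffun 'I_d -> 'I_(2 * N + 1)}) (psi k == boxpt l)%:R * h (boxpt l).
  have [/inbox_ex[l ->]|nin] := pselect (inbox N (psi k)).
    rewrite (bigD1 l)//= eqxx mul1r big1 ?addr0// => l' ll'.
    by rewrite (inj_eq (@boxpt_inj N)) eq_sym (negbTE ll') mul0r.
  rewrite hN// big1// => l _; case: eqP => [pk|_]; last by rewrite mul0r.
  by case: nin; rewrite pk; exact: inbox_boxpt.
rewrite (eq_bigr _ (fun k _ => E k)) exchange_big mulr_sumr ler_sum// => l _.
rewrite -mulr_suml ler_wpM2r// -natr_sum ler_nat (leq_trans _ (hF (boxpt l)))//.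
by rewrite cardE -sum1_size /= [X in (_ <= X)%N]big_enum/= [X in (_ <= X)%N]big_mkcond leq_sum// => k _; rewrite inE; case: eqP.
Qed.


Lemma df_out (f : pt d -> R) (n : nat) v i :
  (forall x, ~ inbox n x -> f x = 0) -> ~ inbox n.+1 v -> df f v i = 0.
Proof.
move=> f0 vn; rewrite /df !f0 ?subrr// => H; apply: vn => j; have := H j;
  rewrite ?[(v + _) 0 j]mxE ?ev_coord; case: (j == i) => /=; lia.
Qed.

Lemma local_energy_out (W : edge d -> R) r (f : pt d -> R) (n : nat) y :
  (forall x, ~ inbox n x -> f x = 0) -> ~ inbox (n.+1 + r) y -> local_energy W r f y = 0.
Proof.
move=> f0 yn; rewrite /local_energy big1// => k _; rewrite big1// => i _.
rewrite (@df_out f n)// ?expr0n ?mulr0// => H; apply: yn => j.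
have := inbox_boxpt r k; move: (boxpt k) H => z H Hz.
by have := H j; have := Hz j; rewrite ptD; lia.
Qed.

(** An edge belongs to at most [(2 * r + 1) ^ d] balls: for each displacement from the center the
    center is determined by the edge. *)
Lemma sum_local_energy (W : edge d -> R) r (f : pt d -> R) (n N : nat) :
  (forall e, 0 <= W e) -> (forall x, ~ inbox n x -> f x = 0) ->
  \sum_(k : {ffun 'I_d -> 'I_(2 * N + 1)}) local_energy W r f (boxpt k) <=
  ((2 * r + 1) ^ d)%:R * local_energy W n.+1 f 0.
Proof.
move=> W0 f0; rewrite {1}/local_energy exchange_big/=.
have -> : ((2 * r + 1) ^ d)%:R * local_energy W n.+1 f 0 =
    \sum_(k : {ffun 'I_d -> 'I_(2 * r + 1)}) local_energy W n.+1 f 0.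
  by rewrite sumr_const card_ffun !card_ord mulr_natl.
apply: ler_sum => l _.
pose h v := \sum_(i < d) W (v, i) * df f v i ^+ 2.
have := @sum_fiber_le {ffun 'I_d -> 'I_(2 * N + 1)} (fun k => boxpt k + boxpt l) n.+1 1 h.
rewrite mul1r /local_energy => H; apply: le_trans (H _ _ _) _.
- by move=> v; apply: sumr_ge0 => i _; rewrite mulr_ge0 ?sqr_ge0.
- move=> v vn; rewrite /h big1// => i _.
  by rewrite (@df_out f n)// ?expr0n ?mulr0.
- move=> v; apply/card_le1_eqP => k k'; rewrite !inE => /eqP <- /eqP.
  by move=> /addIr/boxpt_inj.
- by apply: ler_sum => k _; rewrite add0r.
Qed.

(** Follows from [2 sqrt(a b) <= t a + b / t], summed and taken at [t = S / A], where [S] is the sum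
    of the square roots and [A] that of the [a i]. *)
Lemma cauchy_schwarz_sqrt (I : finType) (a b : I -> R) :
  (forall l, 0 <= a l) -> (forall l, 0 <= b l) ->
  (\sum_i Num.sqrt (a i * b i)) ^+ 2 <= (\sum_i a i) * (\sum_i b i).
Proof.
move=> a0 b0.
have Sa : 0 <= \sum_i a i by apply: sumr_ge0.
have Sb : 0 <= \sum_i b i by apply: sumr_ge0.
set A := \sum_i a i in Sa *; set B := \sum_i b i in Sb *.
have key (t : R) : 0 < t -> 2 * \sum_i Num.sqrt (a i * b i) <= t * A + t^-1 * B.
  move=> t0; rewrite /A /B !mulr_sumr -big_split/= ler_sum// => i _.
  have ta : 0 <= t * a i by rewrite mulr_ge0// ltW.
  have tb : 0 <= t^-1 * b i by rewrite mulr_ge0// invr_ge0 ltW.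
  have -> : a i * b i = (t * a i) * (t^-1 * b i).
    by rewrite mulrACA divff ?mul1r// gt_eqF.
  rewrite sqrtrM//.
  rewrite -{2}(sqr_sqrtr ta) -{2}(sqr_sqrtr tb).
  have := sqr_ge0 (Num.sqrt (t * a i) - Num.sqrt (t^-1 * b i)).
  by rewrite sqrrB; nra.
set S := \sum_i _ in key *.
have S0 : 0 <= S by apply: sumr_ge0 => i _; exact: sqrtr_ge0.
have [/eqP A0|A0] := eqVneq A 0.
  have -> : S = 0.
    rewrite /S big1// => i _.
    move: A0; rewrite /A psumr_eq0// => /allP/(_ i (mem_index_enum _))/eqP ->.
    by rewrite mul0r sqrtr0.
  by rewrite expr0n/= mulr_ge0.
have Ap : 0 < A by rewrite lt_neqAle eq_sym A0.
have [S00|S00] := eqVneq S 0; first by rewrite S00 expr0n/= mulr_ge0.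
have Sp : 0 < S by rewrite lt_neqAle eq_sym S00.
have := key (S / A) (divr_gt0 Sp Ap).
rewrite mulfVK// invf_div => H.
have : S <= A / S * B by lra.
by rewrite mulrAC ler_pdivlMr// expr2.
Qed.


(** A point lies on the lines of those box points only that agree with it off [i0], and these are
    told apart by their [i0]-th coordinate; hence the multiplicity [2 * n + 1]. *)
Lemma sum_lines (h : pt d -> R) (i0 : 'I_d) (n N : nat) :
  (forall v, 0 <= h v) -> (forall v, ~ inbox N v -> h v = 0) ->
  \sum_(k : {ffun 'I_d -> 'I_(2 * n + 1)}) \sum_(c < 2 * N + 1)
    h (set_coord (boxpt k) i0 ((c : nat)%:Z - N%:Z)) <=
  (2 * n + 1)%:R * \sum_(k : {ffun 'I_d -> 'I_(2 * N + 1)}) h (boxpt k).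
Proof.
move=> h0 hN; rewrite pair_big/=.
apply: (@sum_fiber_le ({ffun 'I_d -> 'I_(2 * n + 1)} * 'I_(2 * N + 1))%type
  (fun p => set_coord (boxpt p.1) i0 ((p.2 : nat)%:Z - N%:Z))) => // v.
set A := finset _.
rewrite -(@card_in_imset _ _ (fun p : {ffun 'I_d -> 'I_(2 * n + 1)} * 'I_(2 * N + 1) => p.1 i0) A); first by rewrite (leq_trans (max_card _))// card_ord.
move=> [k c] [k' c']; rewrite !inE/= => /eqP <- /eqP/rowP H kk.
congr pair.
  apply/ffunP => j; have [->//|ji] := eqVneq j i0.
  by have := H j; rewrite !mxE (negbTE ji) => E; apply/val_inj => /=; lia.
by apply/val_inj => /=; have := H i0; rewrite !mxE eqxx; lia.
Qed.

Lemma sqr_leD (a b : R) : (a + b) ^+ 2 <= 2 * a ^+ 2 + 2 * b ^+ 2.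
Proof. by have := sqr_ge0 (a - b); rewrite !expr2; nra. Qed.

(** [f x] is split as [(f x - f (phi x)) + f (phi x)]. The first term is local and pays [1 / t]; the
    second is carried from hub to hub along the line in direction [i0] until [f] vanishes, and pays
    only the sum [S] of [1 / Z] over the line. *)
Lemma weighted_poincare (W : edge d -> R) (n r M : nat) (t S : R) (Z : pt d -> R)
    (i0 : 'I_d) (f : pt d -> R) :
  (2 <= d)%N -> (forall e, 0 < W e) -> 0 < t ->
  (2 * d < M)%N -> (2 * M + 1 <= r)%N -> (r + 2 <= n)%N ->
  (forall x, inbox n x -> exists b a, t < W (b, a) /\ (x = b \/ x = b + ev a)) ->
  (forall y, inbox (2 * n) y -> (nbad r (fun e => (W e <= t)%R) y <= 2 * d)%N) ->
  (forall y, inbox (2 * n) y -> 0 < Z y /\ (nbad r (fun e => (W e <= Z y)%R) y < M)%N) ->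
  (forall x, inbox n x ->
     \sum_(c < 2 * (2 * n) + 1) (Z (set_coord x i0 ((c : nat)%:Z - (2 * n)%N%:Z)))^-1 <= S) ->
  (forall x, ~ inbox n x -> f x = 0) ->
  \sum_(k : {ffun 'I_d -> 'I_(2 * n + 1)}) f (boxpt k) ^+ 2 <=
    (2 * (1 + (2 * d + 1) + 2 * (d * (2 * r)))%:R ^+ 2 * ((2 * r + 1) ^ d)%:R / t
     + 8 * (2 * (d * (2 * r))%:R) ^+ 2 * (2 * n + 1)%:R * ((2 * r + 1) ^ d)%:R * S)
    * local_energy W n.+1 f 0.
Proof.
move=> d2 Wp t0 dM Mr rn good bad_t bad_Z lines f0.
have W0 e : 0 <= W e by exact: ltW.
set K1 : R := (1 + _ + _)%:R; set K2 : R := 2 * (d * _)%:R; set F : R := (_ ^ d)%:R.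
set E := local_energy W n.+1 f 0.
pose LE := local_energy W r f.
have LE0 y : 0 <= LE y by exact: local_energy_ge0.
(* One hub must be clean both for the edges below [t] (attachment) and for those below [Z y]
   (transport). Whichever threshold is larger, the corresponding hypothesis keeps the number of bad
   edges below [M]. *)
pose s y := Num.max t (Z y).
have st y : t <= s y by rewrite le_max lexx.
have sZ y : Z y <= s y by rewrite le_max lexx orbT.
have s0 y : 0 < s y by exact: lt_le_trans t0 (st y).
pose beta y (e : edge d) := W e <= s y.
have nM y : inbox (2 * n) y -> (nbad r (beta y) y < M)%N.
  move=> yn; have [_ ZM] := bad_Z y yn.
  have [tZ|Zt] := leP t (Z y); rewrite /beta /s; first by rewrite (max_idPr tZ).
  by rewrite (max_idPl (ltW Zt)) (leq_ltn_trans (bad_t y yn)).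
have Mr' : (M <= r)%N by lia.
have /choice[phi phiP] y : exists x, inbox (2 * n) y -> hub r (beta y) y x.
  have [yn|] := pselect (inbox (2 * n) y); last by exists 0.
  by have [x hx] := exists_hub r (beta y) y M (nM y yn) Mr'; exists x.
pose tau y := Num.sqrt (LE y / s y).
have tau0 y : 0 <= tau y by exact: sqrtr_ge0.
have good_df y v i : inbox r (v - y) -> ~~ beta y (v, i) -> `|df f v i| <= tau y.
  by move=> vr; rewrite -ltNge => /ltW sW; exact: df_local_energy.
have partA x : inbox n x -> (f x - f (phi x)) ^+ 2 <= K1 ^+ 2 * (LE x / t).
  move=> xn.
  have x2n : inbox (2 * n) x by move=> j; have := xn j; lia.
  have [b [a [tW xb]]] := good x xn.
  have H : `|f x - f (phi x)| <= K1 * Num.sqrt (LE x / t).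
    apply: (@attach_hub r (fun e => W e <= t) x f _ (sqrtr_ge0 _) _ (phi x) b a) => //.
    - by move=> v i vr; rewrite -ltNge => /ltW sW; exact: df_local_energy.
    - by lia.
    - exact: bad_t.
    - by apply: (@hub_sub r _ (beta x)) => [e /le_trans|]; [apply; exact: st|exact: phiP].
    - by rewrite -ltNge.
  have nn : 0 <= LE x / t by rewrite divr_ge0// ltW.
  rewrite -real_normK ?num_real// -(sqr_sqrtr nn) -exprMn ler_sqr ?nnegrE//.
  by rewrite mulr_ge0 ?sqrtr_ge0 ?ler0n.
have partB x : inbox n x -> f (phi x) ^+ 2 <= 4 * K2 ^+ 2 * (S *
    \sum_(c < 2 * (2 * n) + 1) LE (set_coord x i0 ((c : nat)%:Z - (2 * n)%N%:Z))).
  move=> xn.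
  pose y (c : nat) : pt d := set_coord x i0 (c%:Z - (2 * n)%N%:Z).
  have yin (c : nat) : (c <= 2 * (2 * n))%N -> inbox (2 * n) (y c).
    by move=> cn j; rewrite mxE; case: eqP => _; [lia|have := xn j; lia].
  have K20 : 0 <= K2 by rewrite mulr_ge0// ler0n.
  (* The line is followed up to coordinate [2 n] because a hub may lie [r] away from its center: at
     the end its [i0]-th coordinate is at least [2 n - r > n], so [f] vanishes there. *)
  have tele (m c : nat) : (c + m = 2 * (2 * n))%N -> `|f (phi (y c))| <=
      K2 * (\sum_(c <= l < 2 * (2 * n)) tau (y l) + \sum_(c <= l < 2 * (2 * n)) tau (y l.+1)).
    elim: m c => [c|m IH c cm].
      rewrite addn0 => cE.
      have [pr _] := phiP (y c) (yin c (eq_leq cE)).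
      rewrite f0 ?normr0; last first.
        move=> /(_ i0); move/inboxB: pr => /(_ i0); rewrite [y c 0 i0]mxE eqxx; lia.
      by rewrite mulr_ge0// addr_ge0// sumr_ge0.
    have cS : (c.+1 + m = 2 * (2 * n))%N by lia.
    have cl : (c < 2 * (2 * n))%N by lia.
    rewrite !(@big_ltn _ _ _ c)//.
    have step : `|f (phi (y c)) - f (phi (y c.+1))| <= K2 * (tau (y c) + tau (y c.+1)).
      apply: (@hub_step r (beta (y c)) (beta (y c.+1)) (y c) (y c.+1) f _ _ _ _ M) => //.
      - exact: good_df.
      - exact: good_df.
      - by move=> j; rewrite !mxE; case: eqP => _; lia.
      - by apply: nM; apply: yin; lia.
      - by apply: nM; apply: yin; lia.
      - by apply: phiP; apply: yin; lia.
      - by apply: phiP; apply: yin; lia.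
    have := IH c.+1 cS.
    have -> : f (phi (y c)) = (f (phi (y c)) - f (phi (y c.+1))) + f (phi (y c.+1)) by ring.
    move=> IHc; rewrite addrACA mulrDr (le_trans (ler_normD _ _))// lerD//.
  pose T := \sum_(c < 2 * (2 * n) + 1) tau (y c).
  have fT : `|f (phi x)| <= 2 * K2 * T.
    pose c := absz (x 0 i0 + (2 * n)%N%:Z)%R.
    have xc : x = y c.
      by rewrite /y set_coord_id// /c; have := xn i0; lia.
    have c4 : (c <= 2 * (2 * n))%N by rewrite /c; have := xn i0; lia.
    have := tele (2 * (2 * n) - c)%N c; rewrite subnKC// -xc => /(_ erefl) /le_trans; apply.
    have -> : 2 * K2 * T = K2 * (T + T) by ring.
    rewrite ler_wpM2l//.
    have TE : T = \sum_(0 <= l < (2 * (2 * n)).+1) tau (y l) by rewrite big_mkord -addn1.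
    rewrite TE; apply: lerD.
      rewrite (@big_cat_nat _ _ _ c 0 (2 * (2 * n)).+1)//= ?(leq_trans c4)// ler_wpDl ?sumr_ge0//.
      rewrite big_nat_recr//= ler_wpDr//.
    have -> : \sum_(c <= l < 2 * (2 * n)) tau (y l.+1) = \sum_(c.+1 <= l < (2 * (2 * n)).+1) tau (y l).
      by rewrite big_add1.
    rewrite (@big_cat_nat _ _ _ c.+1 0 (2 * (2 * n)).+1)//= ler_wpDl ?sumr_ge0//.
  have T0 : 0 <= T by apply: sumr_ge0.
  (* Cauchy-Schwarz separates the resistances [1 / Z] from the local energies; [Z y <= s y] allows
     [s] to be replaced by [Z]. *)
  have T2 : T ^+ 2 <= S * \sum_(c < 2 * (2 * n) + 1) LE (y c).
    have H : T <= \sum_(c < 2 * (2 * n) + 1) Num.sqrt ((Z (y c))^-1 * LE (y c)).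
      apply: ler_sum => c _; rewrite /tau ler_wsqrtr// mulrC ler_wpM2r//.
      have [Zp _] := bad_Z (y c) (yin c (ltac:(have := ltn_ord c; lia))).
      by rewrite lef_pV2 ?posrE.
    have := @cauchy_schwarz_sqrt _ (fun c : 'I_(2 * (2 * n) + 1) => (Z (y c))^-1) (fun c : 'I_(2 * (2 * n) + 1) => LE (y c)).
    move=> CS; apply: le_trans (le_trans (CS _ _) _).
    - by rewrite ler_sqr ?nnegrE// (le_trans T0).
    - move=> c; have [Zp _] := bad_Z (y c) (yin c (ltac:(have := ltn_ord c; lia))).
      by rewrite invr_ge0 ltW.
    - by [].
    - by rewrite ler_wpM2r ?sumr_ge0//; exact: lines.
  rewrite -real_normK ?num_real//.
  have := fT; rewrite -ler_sqr ?nnegrE ?mulr_ge0// => /le_trans; apply.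
  have -> : (2 * K2 * T) ^+ 2 = 4 * K2 ^+ 2 * T ^+ 2 by ring.
  by rewrite ler_wpM2l// mulr_ge0 ?sqr_ge0.
have S0 : 0 <= S.
  apply: le_trans (lines 0 _); last by move=> j; rewrite mxE.
  apply: sumr_ge0 => c _.
  have [|Zp _] := bad_Z (set_coord 0 i0 ((c : nat)%:Z - (2 * n)%N%:Z)).
    by move=> j; rewrite !mxE; case: eqP => _; have := ltn_ord c; lia.
  by rewrite invr_ge0 ltW.
have sumA : \sum_(k : {ffun 'I_d -> 'I_(2 * n + 1)}) LE (boxpt k) <= F * E.
  exact: sum_local_energy.
have sumB : \sum_(k : {ffun 'I_d -> 'I_(2 * n + 1)}) \sum_(c < 2 * (2 * n) + 1)
    LE (set_coord (boxpt k) i0 ((c : nat)%:Z - (2 * n)%N%:Z)) <= (2 * n + 1)%:R * (F * E).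
  apply: (le_trans (sum_lines LE i0 n (2 * n) LE0 _)).
    move=> v vn; apply: (@local_energy_out W r f n) => // H; apply: vn => j.
    by have := H j; lia.
  by rewrite ler_wpM2l ?ler0n//; exact: sum_local_energy.
have pointwise (k : {ffun 'I_d -> 'I_(2 * n + 1)}) : f (boxpt k) ^+ 2 <=
    2 * K1 ^+ 2 / t * LE (boxpt k) + 8 * K2 ^+ 2 * S * \sum_(c < 2 * (2 * n) + 1)
    LE (set_coord (boxpt k) i0 ((c : nat)%:Z - (2 * n)%N%:Z)).
  have kn := inbox_boxpt n k.
  have -> : f (boxpt k) = (f (boxpt k) - f (phi (boxpt k))) + f (phi (boxpt k)) by ring.
  apply: le_trans (sqr_leD _ _) _.
  by have := partA _ kn; have := partB _ kn; lra.
apply: (le_trans (ler_sum _ (fun k _ => pointwise k))).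
rewrite big_split/= -!mulr_sumr [X in _ <= X]mulrDl; apply: lerD.
  have -> : 2 * K1 ^+ 2 * F / t * E = 2 * K1 ^+ 2 / t * (F * E) by ring.
  by rewrite ler_wpM2l// divr_ge0 ?mulr_ge0 ?sqr_ge0// ltW.
have -> : 8 * K2 ^+ 2 * (2 * n + 1)%:R * F * S * E = 8 * K2 ^+ 2 * S * ((2 * n + 1)%:R * (F * E)).
  by ring.
by rewrite ler_wpM2l// !mulr_ge0// sqr_ge0.
Qed.

End Lattice.
Arguments nbad {d}.
Arguments set_coord {d}.
Arguments local_energy {R d}.

(** * Independent bits *)

Section BitExpectation.
Variables (R : realType) (E : eqType) (p : E -> R).
Hypothesis p01 : forall e, 0 <= p e <= 1.
Implicit Types (b : E -> bool) (F G : (E -> bool) -> R) (s : seq E).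

Definition upd b (e : E) (v : bool) : E -> bool := fun x => if x == e then v else b x.

(* Expectation of F under independent bits of parameters p on s, the other *)
(* bits being frozen to b.                                                 *)
Fixpoint bitE s F b : R :=
  if s is e :: s' then
    p e * bitE s' F (upd b e true) + (1 - p e) * bitE s' F (upd b e false)
  else F b.

Lemma eq_bitE s F G b : (forall b, F b = G b) -> bitE s F b = bitE s G b.
Proof. by move=> FG; elim: s b => [|e s IH] b /=; rewrite ?FG ?IH. Qed.

Lemma le_bitE s F G b : (forall b, F b <= G b) -> bitE s F b <= bitE s G b.
Proof.
move=> FG; elim: s b => [|e s IH] b //=; have /andP[p0 p1] := p01 e.
by rewrite lerD// ler_wpM2l// subr_ge0.
Qed.

Lemma bitE_cst s (c : R) b : bitE s (fun=> c) b = c.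
Proof. by elim: s b => [|e s IH] b //=; rewrite !IH; ring. Qed.

Lemma bitE_ge0 s F b : (forall b, 0 <= F b) -> 0 <= bitE s F b.
Proof. by move=> F0; rewrite -(bitE_cst s 0 b); exact: le_bitE. Qed.

Lemma bitED s F G b : bitE s (fun b => F b + G b) b = bitE s F b + bitE s G b.
Proof. by elim: s b => [|e s IH] b //=; rewrite !IH; ring. Qed.

Lemma bitEZ s (c : R) F b : bitE s (fun b => c * F b) b = c * bitE s F b.
Proof. by elim: s b => [|e s IH] b //=; rewrite !IH; ring. Qed.

Lemma bitEB s F G b : bitE s (fun b => F b - G b) b = bitE s F b - bitE s G b.
Proof. by elim: s b => [|e s IH] b //=; rewrite !IH; ring. Qed.

Lemma bitE_sum (I : Type) (r : seq I) (P : pred I) s (F : I -> (E -> bool) -> R) b :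
  bitE s (fun b => \sum_(i <- r | P i) F i b) b = \sum_(i <- r | P i) bitE s (F i) b.
Proof.
elim: r => [|i r IH].
  rewrite big_nil -[RHS](bitE_cst s 0 b); apply: eq_bitE => b'; by rewrite big_nil.
rewrite big_cons -IH; case: ifP => Pi; [rewrite -bitED|]; apply: eq_bitE => b'.
  by rewrite big_cons Pi.
by rewrite big_cons Pi.
Qed.

Definition depends_on F (A : pred E) : Prop :=
  forall b b', {in A, b =1 b'} -> F b = F b'.

Lemma bitE_depends s F (A : pred E) : depends_on F A -> depends_on (bitE s F) A.
Proof.
move=> FA; elim: s => [|e s IH] //= b b' bb'.
by congr (_ * _ + _ * _); apply: IH => x xA; rewrite /upd; case: eqP => // _; exact: bb'.
Qed.

(** At each bit at least one of the two functions does not see it, so its two conditional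
    expectations coincide and factor out of the average. *)
Lemma bitE_indep s F G (A B : pred E) b : depends_on F A -> depends_on G B ->
  (forall e, A e -> ~~ B e) ->
  bitE s (fun b => F b * G b) b = bitE s F b * bitE s G b.
Proof.
move=> FA GB AB; elim: s b => [|e s IH] b //=; rewrite !IH.
have frozen H (C : pred E) : depends_on H C -> ~~ C e ->
    bitE s H (upd b e true) = bitE s H (upd b e false).
  move=> HC Ce; apply: (bitE_depends s H C HC) => x xC; rewrite /upd.
  by case: eqP => // xe; move: xC; rewrite unfold_in xe (negbTE Ce).
have [Ae|nAe] := boolP (A e).
  by rewrite -(frozen G B GB (AB e Ae)); ring.
by rewrite -(frozen F A FA nAe); ring.
Qed.

Lemma bitE_prod (I : eqType) (r : seq I) s (F : I -> (E -> bool) -> R) (A : I -> pred E) b :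
  uniq r -> (forall i, i \in r -> depends_on (F i) (A i)) ->
  (forall i j e, i \in r -> j \in r -> i != j -> A i e -> ~~ A j e) ->
  bitE s (fun b => \prod_(i <- r) F i b) b = \prod_(i <- r) bitE s (F i) b.
Proof.
elim: r => [_ _ _|i r IH /= /andP[ir ur] FA AA].
  rewrite big_nil -[RHS](bitE_cst s 1 b); apply: eq_bitE => b'; by rewrite big_nil.
rewrite big_cons -IH//; last 2 first.
- by move=> j jr; apply: FA; rewrite inE jr orbT.
- by move=> j k e jr kr; apply: AA; rewrite inE ?jr ?kr orbT.
rewrite -(@bitE_indep s (F i) _ (A i) (fun e => has (fun j => A j e) r))//.
- by apply: eq_bitE => b'; rewrite big_cons.
- by apply: FA; rewrite inE eqxx.
- move=> b1 b2 bb; rewrite !big_seq; apply: eq_bigr => j jr.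
  apply: (FA j); first by rewrite inE jr orbT.
  by move=> e eA; apply: bb; rewrite unfold_in; apply/hasP; exists j.
- move=> e Aie; apply/hasPn => j jr; apply: (AA i j) => //; rewrite ?inE ?eqxx ?jr ?orbT//.
  by apply: contraNneq ir => ->.
Qed.

Lemma bitE_bit s (e : E) b : bitE s (fun b => (b e)%:R) b = if e \in s then p e else (b e)%:R.
Proof.
elim: s b => [|e' s IH] b //=; rewrite !IH inE /upd; case: eqVneq => [<-|_] /=.
  by case: ifP => _; rewrite ?mulr1 ?mulr0; ring.
by case: ifP => _; ring.
Qed.

Lemma bitE_all_bits s (l : seq E) b : uniq l -> {subset l <= s} ->
  bitE s (fun b => \prod_(e <- l) (b e)%:R) b = \prod_(e <- l) p e.
Proof.
move=> ul ls; rewrite (@bitE_prod E l s _ (fun e => pred1 e))//.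
- rewrite big_seq [RHS]big_seq; apply: eq_bigr => e el; by rewrite bitE_bit ls.
- by move=> e _ b1 b2 bb; rewrite (bb e)// inE.
- by move=> i j e _ _ ij /eqP ->.
Qed.

(** The monotonicity is decreasing: a true bit marks a bad edge, and the functions of interest
    express the absence of trapped vertices. *)
Definition bit_mono F : Prop := forall b b', (forall e, b e -> b' e) -> F b' <= F b.

Lemma bitE_mono s F : bit_mono F -> bit_mono (bitE s F).
Proof.
move=> FM; elim: s => [|e s IH] //= b b' bb'; have /andP[p0 p1] := p01 e.
rewrite lerD// ler_wpM2l ?subr_ge0//; apply: IH => x; rewrite /upd; case: eqP => // _; exact: bb'.
Qed.

(** Induction on the bits. With [F1], [F0] and [G1], [G0] the conditional expectations given the
    first bit, the one-bit covariance is [p (1 - p) (F0 - F1) (G0 - G1)], nonnegative because both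
    differences are. *)
Lemma harris s F G b : bit_mono F -> bit_mono G ->
  bitE s F b * bitE s G b <= bitE s (fun b => F b * G b) b.
Proof.
move=> FM GM; elim: s b => [|e s IH] b //=; have /andP[p0 p1] := p01 e.
have up : forall x, upd b e false x -> upd b e true x by move=> x; rewrite /upd; case: eqP.
have HF := bitE_mono s F FM _ _ up; have HG := bitE_mono s G GM _ _ up.
have := IH (upd b e true); have := IH (upd b e false).
move: (bitE s F (upd b e true)) (bitE s F (upd b e false)) HF => F1 F0 HF.
move: (bitE s G (upd b e true)) (bitE s G (upd b e false)) HG => G1 G0 HG.
move: (bitE s _ (upd b e true)) (bitE s _ (upd b e false)) => H1 H0 IH0 IH1.
have q0 : 0 <= 1 - p e by rewrite subr_ge0.
have := ler_wpM2l p0 IH1; have := ler_wpM2l q0 IH0.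
have : 0 <= p e * (1 - p e) * ((F0 - F1) * (G0 - G1)).
  by rewrite !mulr_ge0// subr_ge0.
by move: (p e) => q; nra.
Qed.

Lemma harris_prod (I : Type) (r : seq I) s (F : I -> (E -> bool) -> R) b :
  (forall i b, 0 <= F i b) -> (forall i, bit_mono (F i)) ->
  \prod_(i <- r) bitE s (F i) b <= bitE s (fun b => \prod_(i <- r) F i b) b.
Proof.
move=> F0 FM; elim: r => [|i r IH].
  rewrite big_nil -[X in X <= _](bitE_cst s 1 b); apply: le_bitE => b'; by rewrite big_nil.
rewrite big_cons.
apply: (@le_trans _ _ (bitE s (F i) b * bitE s (fun b => \prod_(j <- r) F j b) b)).
  by rewrite ler_wpM2l// bitE_ge0.
apply: le_trans (harris s _ _ b (FM i) _) _.
  move=> b1 b2 bb; apply: ler_prod => j _; rewrite F0/=; exact: FM.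
by apply: le_bitE => b'; rewrite big_cons.
Qed.

End BitExpectation.
Arguments upd {E}.
Arguments bitE {R E}.
Arguments depends_on {R E}.
Arguments bit_mono {R E}.

(** * From the environment to independent bits *)

Section Link.
Variables (R : realType) (dd : measure_display) (T : measurableType dd)
  (P : probability T R) (d : nat) (w : edge d -> T -> R).
Hypothesis iid : iid_env P w.
Variable t : edge d -> R.

(** The threshold may vary with the edge, so that several annuli, each with its own level, are
    treated in one bit configuration. *)
Definition bits (om : T) : edge d -> bool := fun e => w e om <= t e.
Definition pbit (e : edge d) : R := fine (P (w e @^-1` `]-oo, t e])).

Lemma meas_pre e (B : set R) : measurable B -> measurable (w e @^-1` B).
Proof.
by move=> mB; have [mw _ _ _] := iid; rewrite -[X in measurable X]setTI; exact: mw.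
Qed.

Lemma pbitE e : P (w e @^-1` `]-oo, t e]) = (pbit e)%:E.
Proof. by rewrite /pbit fineK// fin_num_measure//; exact: meas_pre. Qed.

Lemma pbit01 e : 0 <= pbit e <= 1.
Proof.
have mA := meas_pre e `]-oo, t e] (measurable_itv _).
by rewrite -!lee_fin -pbitE measure_ge0 probability_le1.
Qed.

Lemma pbitC e : P (w e @^-1` `]t e, +oo[) = (1 - pbit e)%:E.
Proof.
have mA := meas_pre e `]-oo, t e] (measurable_itv _).
have -> : w e @^-1` `]t e, +oo[ = ~` (w e @^-1` `]-oo, t e]).
  by apply/seteqP; split=> om /=; rewrite !in_itv/= andbT => H; [apply/negP; rewrite -ltNge|rewrite ltNge; apply/negP].
by rewrite probability_setC// pbitE.
Qed.

Definition over (s : seq (edge d)) (b b' : edge d -> bool) : edge d -> bool :=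
  fun e => if e \in s then b' e else b e.

Lemma over_cons e s b b' : e \notin s -> over (e :: s) b b' = over s (upd b e (b' e)) b'.
Proof.
move=> es; apply/funext => x; rewrite /over inE /upd; case: eqVneq => [->|_] //=.
by rewrite (negbTE es).
Qed.

Lemma measurable_over (F : (edge d -> bool) -> bool) s b : uniq s ->
  measurable [set om | F (over s b (bits om))].
Proof.
elim: s b => [b _|e s IH b /= /andP[es us]].
  have -> : [set om | F (over [::] b (bits om))] = if F b then setT else set0.
    by rewrite (_ : over [::] b = fun=> b)//; case: (F b); apply/seteqP; split.
  by case: ifP.
have -> : [set om | F (over (e :: s) b (bits om))] =
   (w e @^-1` `]-oo, t e] `&` [set om | F (over s (upd b e true) (bits om))]) `|`
   (w e @^-1` `]t e, +oo[ `&` [set om | F (over s (upd b e false) (bits om))]).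
  apply/seteqP; split=> om /=; rewrite !in_itv/= andbT over_cons// (_ : bits om e = (w e om <= t e))// ltNge;
    case: (w e om <= t e).
  - by left.
  - by right.
  - by case=> [[]//|[]].
  - by case=> [[]//|[]].
by apply: measurableU; apply: measurableI; try exact: IH; apply: meas_pre; exact: measurable_itv.
Qed.


(** Each step of the induction splits on [w e <= t e] and moves [e] from [s] into the rectangle
    indexed by [r]. The rectangle is carried along because independence in [iid_env] is stated for
    rectangles. *)
Lemma prob_over (F : (edge d -> bool) -> bool) s b (r : seq (edge d)) (B : edge d -> set R) :
  uniq (r ++ s) -> (forall e, measurable (B e)) ->
  P ((\bigcap_(e in [set e | e \in r]) (w e @^-1` B e)) `&`
     [set om | F (over s b (bits om))]) =
  (\prod_(e <- r) P (w e @^-1` B e) * (bitE pbit s (fun b => (F b)%:R) b)%:E)%E.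
Proof.
move=> + mB; have [_ _ _ indep] := iid.
have mbig (q : seq (edge d)) B' : (forall e, measurable (B' e)) ->
    measurable (\bigcap_(e in [set e | e \in q]) (w e @^-1` B' e)).
  move=> mB'; apply: fin_bigcap_measurable => [|e _]; last exact: meas_pre.
  exact: finite_seq.
elim: s b r B mB => [|e s IH] b r B mB urs.
  have -> : [set om | F (over [::] b (bits om))] = if F b then setT else set0.
    by rewrite (_ : over [::] b = fun=> b)//; case: (F b); apply/seteqP; split.
  rewrite /=; rewrite cats0 in urs; case: (F b); first by rewrite setIT mule1 indep.
  by rewrite setI0 measure0 mule0.
have [ur er us es] : [/\ uniq r, e \notin r, uniq s & e \notin s].
  move: urs; rewrite cat_uniq /= => /and3P[-> H /andP[-> ->]]; split=> //.
  by move: H; rewrite negb_or => /andP[].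
have ures : uniq ((e :: r) ++ s).
  by move: urs; rewrite -[e :: s]cat1s uniq_catCA.
pose BB (I : set R) x := if x == e then I else B x.
have mBB I : measurable I -> forall x, measurable (BB I x).
  by move=> mI x; rewrite /BB; case: eqP.
have capE I : \bigcap_(x in [set x | x \in e :: r]) (w x @^-1` BB I x) =
    (w e @^-1` I) `&` \bigcap_(x in [set x | x \in r]) (w x @^-1` B x).
  apply/seteqP; split=> om H.
    split; first by have := H e; rewrite /BB eqxx; apply; rewrite /= inE eqxx.
    move=> x /= xr; have := H x; rewrite /BB; case: eqP => [xe|_]; first by rewrite -xe xr in er.
    by apply; rewrite /= inE xr orbT.
  move=> x /=; rewrite inE /BB; case: eqP => [-> _|_ /= xr]; first by case: H.
  by case: H => _; apply.
have prodE I : (\prod_(x <- e :: r) P (w x @^-1` BB I x) =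
    P (w e @^-1` I) * \prod_(x <- r) P (w x @^-1` B x))%E.
  rewrite big_cons /BB eqxx; congr (_ * _)%E; rewrite !big_seq; apply: eq_bigr => x xr.
  by case: eqP => // xe; rewrite -xe xr in er.
have It := measurable_itv `]-oo, t e]; have Iq := measurable_itv `]t e, +oo[.
have H1 := IH (upd b e true) (e :: r) (BB [set` `]-oo, t e]]) (mBB _ It) ures.
have H0 := IH (upd b e false) (e :: r) (BB [set` `]t e, +oo[]) (mBB _ Iq) ures.
rewrite capE prodE pbitE in H1; rewrite capE prodE pbitC in H0.
set C := \bigcap_(x in _) _ in H1 H0 *.
have mC : measurable C by exact: mbig.
have -> : C `&` [set om | F (over (e :: s) b (bits om))] =
   (w e @^-1` `]-oo, t e] `&` C `&` [set om | F (over s (upd b e true) (bits om))]) `|`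
   (w e @^-1` `]t e, +oo[ `&` C `&` [set om | F (over s (upd b e false) (bits om))]).
  apply/seteqP; split=> om /=; rewrite !in_itv/= andbT over_cons// (_ : bits om e = (w e om <= t e))// ltNge;
    case: (w e om <= t e).
  - by case; left.
  - by case; right.
  - by case=> [[[]]//|[[]]].
  - by case=> [[[]]//|[[]]].
rewrite measureU; last 3 first.
- by apply: measurableI; [apply: measurableI => //; exact: meas_pre|exact: measurable_over].
- by apply: measurableI; [apply: measurableI => //; exact: meas_pre|exact: measurable_over].
- apply/seteqP; split=> om //= [[[]]]; rewrite !in_itv/= => H _ _ [[]].
  by rewrite andbT ltNge H.
rewrite [X in (X + _)%E]H1 [X in (_ + X)%E]H0 /=.
have [x ->] : exists x, (\prod_(x <- r) P (w x @^-1` B x) = x%:E)%E.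
  exists (\prod_(x <- r) fine (P (w x @^-1` B x))).
  rewrite -prodEFin; apply: eq_bigr => x _; rewrite fineK// fin_num_measure//; exact: meas_pre.
by rewrite -!EFinM -!EFinD; congr (_%:E); ring.
Qed.

Lemma prob_bits (F : (edge d -> bool) -> bool) s b : uniq s ->
  depends_on (fun b => (F b)%:R : R) (mem s) ->
  measurable [set om | F (bits om)] /\
  P [set om | F (bits om)] = (bitE pbit s (fun b => (F b)%:R) b)%:E.
Proof.
move=> us Fs.
have -> : [set om | F (bits om)] = [set om | F (over s b (bits om))].
  apply/seteqP; split=> om /=; suff -> : F (bits om) = F (over s b (bits om)) by [].
    have := Fs (bits om) (over s b (bits om)).
    rewrite /over => H; have {}H : (F (bits om))%:R = (F (over s b (bits om)))%:R :> R.
      by apply: H => e; rewrite unfold_in => ->.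
    by move/eqP: H; rewrite eqr_nat; case: (F _); case: (F _).
  have := Fs (bits om) (over s b (bits om)).
  rewrite /over => H; have {}H : (F (bits om))%:R = (F (over s b (bits om)))%:R :> R.
    by apply: H => e; rewrite unfold_in => ->.
  by move/eqP: H; rewrite eqr_nat; case: (F _); case: (F _).
split; first exact: measurable_over.
have := prob_over F s b [::] (fun=> setT) us (fun=> measurableT).
rewrite big_nil mul1e => <-; congr (P _); apply/seteqP; split=> om /=; last by case.
by move=> H; split=> //; move=> e.
Qed.

End Link.

Section EdgeLists.
Variable d : nat.
Implicit Types (x y : pt d) (e : edge d).

Definition box_edges (N : nat) : seq (edge d) :=
  [seq (boxpt a.1, a.2) | a <- enum {: {ffun 'I_d -> 'I_(2 * N + 1)} * 'I_d}].

Lemma uniq_box_edges N : uniq (box_edges N).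
Proof.
rewrite map_inj_uniq ?enum_uniq// => -[k i] [k' i'] /= [/rowP H ->].
by rewrite (boxpt_inj _ _ _ _ (_ : boxpt k = boxpt k'))//; apply/rowP.
Qed.

Lemma mem_box_edges N e : inbox N e.1 -> e \in box_edges N.
Proof.
case: e => x i /= /inbox_ex[k ->]; apply/mapP; exists (k, i) => //.
by rewrite mem_enum.
Qed.

Definition star x : seq (edge d) :=
  [seq (x, i) | i <- enum 'I_d] ++ [seq (x - ev i, i) | i <- enum 'I_d].

Lemma size_star x : size (star x) = (2 * d)%N.
Proof. by rewrite size_cat [X in (X + _)%N]size_map [X in (_ + X)%N]size_map -cardE card_ord; lia. Qed.

Lemma uniq_star x : uniq (star x).
Proof.
have un (h : 'I_d -> pt d) : uniq [seq (h i, i) | i <- enum 'I_d].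
  by rewrite map_inj_uniq ?enum_uniq// => i j [].
rewrite cat_uniq (un (fun=> x)) (un (fun i => x - ev i)) /= andbT; apply/hasPn => e /mapP[i _ ->]; apply/mapP => -[j _ [H _]].
have := congr1 (fun z : pt d => (z + ev i) 0 i) H.
by rewrite subrK ptD ev_coord eqxx => /(canLR (addKr _)); rewrite addNr.
Qed.

Lemma mem_star x e : (e \in star x) = (e.1 == x) || (x == e.1 + ev e.2).
Proof.
case: e => y i; rewrite mem_cat /=; congr (_ || _); apply/mapP/eqP.
- by case=> j _ [].
- by move=> ->; exists i; rewrite ?mem_enum.
- by case=> j _ [-> ->]; rewrite subrK.
- by move=> ->; exists i; rewrite ?mem_enum ?addrK.
Qed.

Definition trapped (b : edge d -> bool) x : bool := all b (star x).

Definition ball_edges r y : seq (edge d) :=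
  [seq (y + boxpt a.1, a.2) | a <- enum {: {ffun 'I_d -> 'I_(2 * r + 1)} * 'I_d}].

Lemma mem_ball_edges r y e : e \in ball_edges r y -> inbox r (e.1 - y).
Proof.
by case/mapP=> a _ -> /=; rewrite addrAC subrr add0r; exact: inbox_boxpt.
Qed.

Lemma ball_edge_inj r y : injective
  (fun a : {ffun 'I_d -> 'I_(2 * r + 1)} * 'I_d => (y + boxpt a.1, a.2) : edge d).
Proof. by move=> [k i] [k' i'] /= [/addrI/boxpt_inj -> ->]. Qed.

End EdgeLists.
Arguments box_edges {d}.
Arguments star {d}.
Arguments trapped {d}.
Arguments ball_edges {d}.

(** * Estimates for bits with one common parameter *)

Section BitBounds.
Variables (R : realType) (d : nat) (p : R).
Hypothesis p01 : 0 <= p <= 1.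
Implicit Types (x y : pt d) (s : seq (edge d)) (b : edge d -> bool).
Local Notation bE := (bitE (fun _ : edge d => p)).

Lemma trapped_prod b x : (trapped b x)%:R = \prod_(e <- star x) (b e)%:R :> R.
Proof.
rewrite /trapped; elim: (star x) => [|e l IH] /=; first by rewrite big_nil.
by rewrite big_cons -IH; case: (b e); rewrite ?mul1r ?mul0r.
Qed.

Lemma bitE_trapped s x b : {subset star x <= s} ->
  bE s (fun b => (trapped b x)%:R) b = p ^+ (2 * d).
Proof.
move=> xs; rewrite (eq_bitE _ _ _ _ _ _ _ (fun b => trapped_prod b x)).
by rewrite bitE_all_bits ?uniq_star// big_const_seq count_predT size_star iter_mulr_1.
Qed.

(** Union bound over the sets of [m] edges of the ball, all of whose bits must be true. Their number
    is bounded by that of all subsets; [(2 * r + 1) ^ d * d] is the number of edges. *)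
Lemma bitE_nbad s r y (m : nat) b : {subset ball_edges r y <= s} ->
  bE s (fun b => (m <= nbad r b y)%N%:R) b <= (2 ^ ((2 * r + 1) ^ d * d))%:R * p ^+ m.
Proof.
move=> ys; have /andP[p0 p1] := p01.
pose K := ({ffun 'I_d -> 'I_(2 * r + 1)} * 'I_d)%type.
pose ed (a : K) : edge d := (y + boxpt a.1, a.2).
pose G (S : {set K}) (b : edge d -> bool) : R := \prod_(e <- [seq ed a | a <- enum S]) (b e)%:R.
have G0 S b' : 0 <= G S b' by apply: prodr_ge0 => e _; exact: ler0n.
apply: (@le_trans _ _ (bE s (fun b => \sum_(S : {set K} | #|S| == m) G S b) b)).
  apply: le_bitE => // b'; have [le|_] := leqP m (nbad r b' y); last by rewrite sumr_ge0.
  have [l [ul sl lA]] := card_geqP le.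
  pose S : {set K} := [set a in l]%SET.
  have cS : #|S| == m by rewrite cardsE (card_uniqP ul) sl.
  rewrite (bigD1 S)//= ler_wpDr ?sumr_ge0// /G big_map big_seq big1// => a.
  by rewrite mem_enum inE => /lA; rewrite inE => ->.
rewrite bitE_sum.
have E (S : {set K}) : #|S| == m -> bE s (G S) b = p ^+ m.
  move=> /eqP cS; rewrite /G bitE_all_bits ?map_inj_uniq ?enum_uniq//; last 2 first.
  - exact: ball_edge_inj.
  - by move=> e /mapP[a _ ->]; apply: ys; apply/mapP; exists a; rewrite ?mem_enum.
  by rewrite big_map big_const_seq count_predT -cardE cS iter_mulr_1.
rewrite (eq_bigr _ E) big_mkcond/=.
apply: (@le_trans _ _ (\sum_(S : {set K}) p ^+ m)).
  by apply: ler_sum => S _; case: ifP => _; rewrite ?exprn_ge0.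
by rewrite sumr_const -cardsT -powersetT card_powerset cardsT card_prod card_ffun !card_ord mulr_natl.
Qed.


Lemma nbad_depends r (m : nat) y :
  depends_on (fun b => (m <= nbad r b y)%N%:R : R) (mem (ball_edges r y)).
Proof.
move=> b b' bb'; congr (_%:R); congr (nat_of_bool (_ <= _)%N); apply: eq_card => a; rewrite !inE.
by apply: bb'; rewrite unfold_in; apply/mapP; exists a; rewrite ?mem_enum.
Qed.

Lemma bit_markov s (F : (edge d -> bool) -> bool) (G : (edge d -> bool) -> R) (c : R) b :
  0 < c -> (forall b, 0 <= G b) -> (forall b, F b -> c <= G b) ->
  bE s (fun b => (F b)%:R) b <= bE s G b / c.
Proof.
move=> c0 G0 FG; rewrite ler_pdivlMr// mulrC -bitEZ; apply: le_bitE => // b'.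
by case FE: (F b'); rewrite ?mulr1 ?mulr0// FG.
Qed.

(* Exponential Markov inequality: E[2^N] is a product, since centers in one *)
(* residue class have disjoint balls.                                       *)
Lemma bitE_line s r (m sigma N a : nat) x (i0 : 'I_d) b :
  (forall c : 'I_(2 * N + 1), {subset ball_edges r (set_coord x i0 ((c : nat)%:Z - N%:Z)) <= s}) ->
  bE s (fun b => (sigma < #|[set c : 'I_(2 * N + 1) | (c %% (2 * r + 1) == a)%N &&
      (m <= nbad r b (set_coord x i0 ((c : nat)%:Z - N%:Z)))%N]%SET|)%N%:R) b <=
  (1 + (2 ^ ((2 * r + 1) ^ d * d))%:R * p ^+ m) ^+ (2 * N + 1) / 2 ^+ sigma.
Proof.
move=> sub; have /andP[p0 p1] := p01.
pose y (c : 'I_(2 * N + 1)) := set_coord x i0 ((c : nat)%:Z - N%:Z).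
pose cl := [seq c : 'I_(2 * N + 1) <- enum 'I_(2 * N + 1) | (c %% (2 * r + 1) == a)%N].
pose G (c : 'I_(2 * N + 1)) b : R := 1 + (m <= nbad r b (y c))%N%:R.
have G1 c b' : 1 <= G c b' by rewrite lerDl ler0n.
apply: le_trans (bit_markov s _ (fun b => \prod_(c <- cl) G c b) (2 ^+ sigma) b _ _ _) _.
- by rewrite exprn_gt0.
- by move=> b'; apply: prodr_ge0 => c _; exact: le_trans (G1 c b').
- move=> b' Hs; set A := finset _ in Hs.
  have -> : \prod_(c <- cl) G c b' = 2 ^+ #|A|.
    rewrite /cl big_filter big_enum_cond/= -prodr_const big_mkcond [RHS]big_mkcond/=.
    apply: eq_bigr => c _; rewrite inE /G; case: eqP => //= _.
    by case: ifP => _; rewrite ?addr0.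
  by rewrite ler_eXn2l ?ltr1n// ltnW.
rewrite ler_pM2r ?invr_gt0 ?exprn_gt0//.
rewrite (@bitE_prod R _ _ _ cl s G (fun c => mem (ball_edges r (y c))))//; first last.
- move=> c c' e; rewrite !mem_filter => /andP[/eqP ca _] /andP[/eqP c'a _] cc' ec.
  apply/negP => ec'; move/eqP: cc'; apply; apply/val_inj => /=.
  have /inboxB/(_ i0) := mem_ball_edges _ _ _ _ ec.
  have /inboxB/(_ i0) := mem_ball_edges _ _ _ _ ec'.
  rewrite !mxE eqxx; move: (e.1 0 i0) => z Hz Hz'.
  have := divn_eq c (2 * r + 1); have := divn_eq c' (2 * r + 1); rewrite ca c'a.
  move: (c %/ (2 * r + 1))%N (c' %/ (2 * r + 1))%N => q q'.
  have [->|] := eqVneq q q'; first by move=> -> ->.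
  by rewrite neq_ltn => /orP[] /(fun h => leq_mul h (leqnn (2 * r + 1))); lia.
- move=> c _ b1 b2 bb; rewrite /G; congr (1 + _); exact: nbad_depends.
- by rewrite filter_uniq ?enum_uniq.
apply: (@le_trans _ _ (\prod_(c <- cl) (1 + (2 ^ ((2 * r + 1) ^ d * d))%:R * p ^+ m))).
  apply: ler_prod => c _; rewrite bitE_ge0 ?(fun=> p01)//=; last first.
    by move=> b'; exact: le_trans (G1 c b').
  by rewrite bitED bitE_cst lerD2l bitE_nbad//; exact: sub.
rewrite big_const_seq iter_mulr_1 count_predT ler_weXn2l//; last first.
  by rewrite size_filter (leq_trans (count_size _ _))// -cardE card_ord.
by rewrite lerDl mulr_ge0 ?exprn_ge0 ?ler0n.
Qed.

End BitBounds.

(** * Union bounds for the environment *)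

Section ProbBounds.
Variables (R : realType) (dd : measure_display) (T : measurableType dd)
  (P : probability T R) (d : nat) (w : edge d -> T -> R) (e0 : edge d).
Hypothesis iid : iid_env P w.

Definition pr (s : R) : R := fine (P [set om | w e0 om <= s]).

Lemma pbit_pr (t : edge d -> R) e : pbit R dd T P d w t e = pr (t e).
Proof.
rewrite /pbit /pr; have [_ _ id _] := iid; rewrite (id e e0) ; last exact: measurable_itv.
by congr (fine (P _)); apply/seteqP; split=> om /=; rewrite in_itv.
Qed.

Lemma pr01 s : 0 <= pr s <= 1.
Proof. by have := pbit01 R dd T P d w iid (fun=> s) e0; rewrite pbit_pr. Qed.

Lemma le_pr s s' : s <= s' -> pr s <= pr s'.
Proof.
move=> ss'; have ms u : measurable [set om | w e0 om <= u].
  rewrite (_ : [set om | w e0 om <= u] = w e0 @^-1` `]-oo, u]).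
    by apply: (meas_pre R dd T P d w iid); exact: measurable_itv.
  by apply/seteqP; split=> om /=; rewrite in_itv.
rewrite /pr fine_le ?fin_num_measure//.
by apply: le_measure; rewrite ?inE// => om /= /le_trans; apply.
Qed.

Lemma prob_union (K : finType) (F : K -> (edge d -> bool) -> bool) (N : nat) (s B : R) :
  (forall k, depends_on (fun b => (F k b)%:R : R) (mem (box_edges N))) ->
  (forall k, bitE (fun=> pr s) (box_edges N) (fun b => (F k b)%:R) (fun=> false) <= B) ->
  measurable [set om | exists k, F k (fun e => (w e om <= s)%R)] /\
  (P [set om | exists k, F k (fun e => (w e om <= s)%R)] <= (#|K|%:R * B)%:E)%E.
Proof.
move=> Fdep FB.
pose F' (b : edge d -> bool) := [exists k, F k b].
have F'dep : depends_on (fun b => (F' b)%:R : R) (mem (box_edges N)).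
  move=> b b' bb'; congr (_%:R); rewrite /F'; congr (nat_of_bool _).
  apply: eq_existsb => k; have /eqP := Fdep k b b' bb'.
  by rewrite eqr_nat; case: (F k b); case: (F k b').
have [mF PF] := prob_bits R dd T P d w iid (fun=> s) F' (box_edges N) (fun=> false)
  (uniq_box_edges d N) F'dep.
have E : [set om | exists k, F k (fun e => (w e om <= s)%R)] =
    [set om | F' (bits R dd T d w (fun=> s) om)].
  by apply/seteqP; split=> om /=; [move=> H; apply/existsP|move=> /existsP].
rewrite E; split=> //; rewrite PF lee_fin.
have -> : pbit R dd T P d w (fun=> s) = fun=> pr s by apply/funext => e; rewrite pbit_pr.
have H b : (F' b)%:R <= \sum_k (F k b)%:R :> R.
  rewrite /F'; case: existsP => [[k Fk]|_]; last by rewrite sumr_ge0// => k _; exact: ler0n.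
  by rewrite (bigD1 k)//= Fk lerDl sumr_ge0// => j _; exact: ler0n.
apply: le_trans (le_bitE _ _ _ (fun=> pr01 s) _ _ _ _ H) _.
rewrite bitE_sum mulr_natl -sumr_const ler_sum// => k _; exact: FB.
Qed.

Lemma prob_trap_box (N : nat) (s : R) :
  measurable [set om | exists k : {ffun 'I_d -> 'I_(2 * N + 1)},
     trapped (fun e => (w e om <= s)%R) (boxpt k)] /\
  (P [set om | exists k : {ffun 'I_d -> 'I_(2 * N + 1)},
     trapped (fun e => (w e om <= s)%R) (boxpt k)] <= (((2 * N + 1) ^ d)%:R * pr s ^+ (2 * d))%:E)%E.
Proof.
have sub (k : {ffun 'I_d -> 'I_(2 * N + 1)}) : {subset star (boxpt k) <= box_edges (N.+1)}.
  move=> e; rewrite mem_star => ek; apply: mem_box_edges => j.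
  have := inbox_boxpt d N k j; case/orP: ek => /eqP E; first by rewrite E; lia.
  by rewrite E ptD ev_coord; case: (j == _) => /=; lia.
have [|k|] := @prob_union {ffun 'I_d -> 'I_(2 * N + 1)} (fun k b => trapped b (boxpt k)) N.+1 s (pr s ^+ (2 * d)).
- move=> k b b' bb'; congr (_%:R); congr nat_of_bool; apply: eq_in_all => e ek.
  exact: (bb' e (sub k e ek)).
- by rewrite bitE_trapped.
- by rewrite card_ffun !card_ord.
Qed.

Lemma ball_sub_box r (N : nat) (y : pt d) : inbox N y -> {subset ball_edges r y <= box_edges (N + r)}.
Proof.
move=> yN e /mem_ball_edges/inboxB er; apply: mem_box_edges => j.
by have := er j; have := yN j; lia.
Qed.

Lemma prob_ball_box (r m N : nat) (s : R) :
  measurable [set om | exists k : {ffun 'I_d -> 'I_(2 * N + 1)},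
     (m <= nbad r (fun e => (w e om <= s)%R) (boxpt k))%N] /\
  (P [set om | exists k : {ffun 'I_d -> 'I_(2 * N + 1)},
     (m <= nbad r (fun e => (w e om <= s)%R) (boxpt k))%N] <=
  (((2 * N + 1) ^ d)%:R * ((2 ^ ((2 * r + 1) ^ d * d))%:R * pr s ^+ m))%:E)%E.
Proof.
have sub k := ball_sub_box r N (@boxpt d N k) (inbox_boxpt _ _ _).
have [|k|] := @prob_union {ffun 'I_d -> 'I_(2 * N + 1)} (fun k b => (m <= nbad r b (boxpt k))%N) (N + r) s
  ((2 ^ ((2 * r + 1) ^ d * d))%:R * pr s ^+ m).
- move=> k b b' bb'; apply: nbad_depends => e ek; exact: (bb' e (sub k e ek)).
- by apply: bitE_nbad; [exact: pr01|exact: sub].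
- by rewrite card_ffun !card_ord.
Qed.

(** Centers are restricted to one residue class modulo [2 * r + 1] so that their balls share no edge
    and are independent. *)
Definition line_count r m N (a : nat) (b : edge d -> bool) (x : pt d) (i0 : 'I_d) : nat :=
  #|[set c : 'I_(2 * N + 1) | (c %% (2 * r + 1) == a)%N &&
      (m <= nbad r b (set_coord x i0 ((c : nat)%:Z - N%:Z)))%N]%SET|.

Lemma prob_line_box (r m n N sigma : nat) (i0 : 'I_d) (s : R) : (n <= N)%N ->
  measurable [set om | exists k : {ffun 'I_d -> 'I_(2 * n + 1)} * 'I_(2 * r + 1),
     (sigma < line_count r m N k.2 (fun e => (w e om <= s)%R) (boxpt k.1) i0)%N] /\
  (P [set om | exists k : {ffun 'I_d -> 'I_(2 * n + 1)} * 'I_(2 * r + 1),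
     (sigma < line_count r m N k.2 (fun e => (w e om <= s)%R) (boxpt k.1) i0)%N] <=
  (((2 * n + 1) ^ d * (2 * r + 1))%:R *
   ((1 + (2 ^ ((2 * r + 1) ^ d * d))%:R * pr s ^+ m) ^+ (2 * N + 1) / 2 ^+ sigma))%:E)%E.
Proof.
move=> nN.
have sub (k : {ffun 'I_d -> 'I_(2 * n + 1)}) (c : 'I_(2 * N + 1)) :
    {subset ball_edges r (set_coord (boxpt k) i0 ((c : nat)%:Z - N%:Z)) <= box_edges (N + r)}.
  apply: ball_sub_box => j; rewrite mxE; case: eqP => _; first by have := ltn_ord c; lia.
  by have := inbox_boxpt d n k j; lia.
have [|k|] := @prob_union ({ffun 'I_d -> 'I_(2 * n + 1)} * 'I_(2 * r + 1))%type
  (fun k b => (sigma < line_count r m N k.2 b (boxpt k.1) i0)%N) (N + r) s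
  ((1 + (2 ^ ((2 * r + 1) ^ d * d))%:R * pr s ^+ m) ^+ (2 * N + 1) / 2 ^+ sigma).
- move=> k b b' bb'; congr (_%:R); congr (nat_of_bool (_ < _)%N); apply: eq_card => c; rewrite !inE.
  congr (_ && _); have /eqP := nbad_depends R d r m (set_coord (boxpt k.1) i0 ((c : nat)%:Z - N%:Z)) b b'
    (fun e ek => bb' e (sub k.1 c e ek)).
  by rewrite eqr_nat; case: (_ <= _)%N; case: (_ <= _)%N.
- by apply: bitE_line; [exact: pr01|exact: sub].
- by rewrite card_prod card_ffun !card_ord.
Qed.

End ProbBounds.

(** * Annuli and Borel-Cantelli lemmas *)

Section Annuli.
Variables (R : realType) (dd : measure_display) (T : measurableType dd)
  (P : probability T R) (d : nat) (w : edge d -> T -> R) (e0 : edge d).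
Hypothesis iid : iid_env P w.
Variables (n : nat -> nat) (lev : nat -> R).
Hypothesis n_mono : forall j k, (j <= k)%N -> (n j <= n k)%N.
Local Notation pr := (pr R dd T P d w e0).

Definition inboxb (N : nat) (x : pt d) : bool := [forall j, `|x 0 j| <= N%:Z].

Lemma inboxP N x : reflect (inbox N x) (inboxb N x).
Proof. exact: forallP. Qed.

Definition annulus (N N' : nat) : seq (pt d) :=
  [seq x <- [seq boxpt k | k <- enum {: {ffun 'I_d -> 'I_(2 * N' + 1)}}] | ~~ inboxb N x].

Lemma mem_annulus N N' x : x \in annulus N N' -> inbox N' x /\ ~ inbox N x.
Proof.
rewrite mem_filter => /andP[/inboxP xN /mapP[k _ xk]]; split=> //.
by rewrite xk; exact: inbox_boxpt.
Qed.

Lemma annulus_mem N N' x : inbox N' x -> ~ inbox N x -> x \in annulus N N'.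
Proof.
move=> /inbox_ex[k ->] /inboxP xN; rewrite mem_filter xN/=.
by apply/mapP; exists k; rewrite ?mem_enum.
Qed.

Lemma size_annulus N N' : (size (annulus N N') <= (2 * N' + 1) ^ d)%N.
Proof.
rewrite size_filter (leq_trans (count_size _ _))// size_map -cardE card_ffun.
by rewrite !card_ord.
Qed.

(** The extra 1 in the inner radius keeps vertices of distinct blocks at distance at least 2, so
    their stars share no edge and the blocks are independent. *)
Definition block k : seq (pt d) := annulus (n k).+1 (n k.+1).
Definition block_edge k : pred (edge d) := fun e => has (fun x => e \in star x) (block k).

Lemma star_close (x x' : pt d) (e : edge d) : e \in star x -> e \in star x' ->
  forall j, `|x 0 j - x' 0 j| <= 1.
Proof.
rewrite !mem_star => H H' j; case/orP: H => /eqP H; case/orP: H' => /eqP H'.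
- by rewrite -H -H' subrr.
- by rewrite -H H' ptD ev_coord; case: (j == _) => /=; lia.
- by rewrite H -H' ptD ev_coord; case: (j == _) => /=; lia.
- by rewrite H H' subrr.
Qed.

Lemma block_edge_disjoint j k e : j != k -> block_edge j e -> ~~ block_edge k e.
Proof.
wlog jk : j k / (j < k)%N.
  move=> H; rewrite neq_ltn => /orP[jk|kj]; first by apply: H => //; rewrite ltn_eqF.
  by move=> je; apply/negP => /(H k j kj); rewrite ltn_eqF// => /(_ isT); rewrite je.
move=> _ /hasP[x xj ex]; apply/hasPn => x' x'k; apply/negP => ex'.
have [xN _] := mem_annulus _ _ _ xj; have [_] := mem_annulus _ _ _ x'k; apply => i.
have := star_close _ _ _ ex ex' i; have := xN i; have := n_mono j.+1 k jk; lia.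
Qed.

Lemma has_prod (b : edge d -> bool) (l : seq (pt d)) :
  (has (trapped b) l)%:R = 1 - \prod_(x <- l) (1 - (trapped b x)%:R) :> R.
Proof.
elim: l => [|x l IH] /=; first by rewrite big_nil subrr.
rewrite big_cons; move: IH; case: (trapped b x) => /=.
  by rewrite subrr mul0r subr0.
by rewrite subr0 mul1r => ->.
Qed.

Lemma block_depends k :
  depends_on (fun b => (has (trapped b) (block k))%:R : R) (block_edge k).
Proof.
move=> b b' bb'; congr (_%:R); congr nat_of_bool; apply: eq_in_has => x xk.
apply: eq_in_all => e ex; apply: bb'; rewrite unfold_in; apply/hasP; by exists x.
Qed.

(** Blocks factor by disjointness of their edges. Inside a block, [Harris] bounds the probability of
    no trapped vertex from below by a product of factors [1 - pr (lev k) ^+ (2 * d)]; counting all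
    vertices of the box instead of the annulus only lowers that product. *)
Lemma prob_blocks (a m : nat) :
  measurable [set om | all (fun k => has (trapped (fun e => w e om <= lev k)) (block k)) (iota a m)] /\
  (P [set om | all (fun k => has (trapped (fun e => (w e om <= lev k)%R)) (block k)) (iota a m)] <=
   (\prod_(k <- iota a m) (1 - (1 - pr (lev k) ^+ (2 * d)) ^+ ((2 * n k.+1 + 1) ^ d)))%:E)%E.
Proof.
(* An edge meets at most one block, so the sum is the level of that block, or 0 off all blocks. *)
pose th e : R := \sum_(k < a + m | block_edge k e) lev k.
have thE k e : (k < a + m)%N -> block_edge k e -> th e = lev k.
  move=> km ke; rewrite /th (bigD1 (Ordinal km))//= big1 ?addr0// => j /andP[je jk].
  by move: (block_edge_disjoint j k e jk je); rewrite ke.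
pose F b := all (fun k => has (trapped b) (block k)) (iota a m).
have iota_lt k : k \in iota a m -> (k < a + m)%N by rewrite mem_iota => /andP[].
have FE om : F (bits R dd T d w th om) =
    all (fun k => has (trapped (fun e => w e om <= lev k)) (block k)) (iota a m).
  apply: eq_in_all => k km; apply: eq_in_has => x xk; apply: eq_in_all => e ex.
  by rewrite /bits (thE k)//; [exact: iota_lt|apply/hasP; exists x].
pose s := box_edges (d := d) (n (a + m)).+1.
have block_sub k e : (k < a + m)%N -> block_edge k e -> e \in s.
  move=> km /hasP[x /mem_annulus[xN _]]; rewrite mem_star => ex.
  apply: mem_box_edges => j; have := xN j; have := n_mono k.+1 (a + m) km.
  by case/orP: ex => /eqP ->; rewrite ?ptD ?ev_coord; last case: (j == _) => /=; lia.
have FP b : (F b)%:R = \prod_(k <- iota a m) (has (trapped b) (block k))%:R :> R.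
  rewrite /F; elim: (iota a m) => [|k l IH] /=; first by rewrite big_nil.
  by rewrite big_cons -IH; case: (has _ _); rewrite ?mul1r ?mul0r.
have Fdep : depends_on (fun b => (F b)%:R : R) (mem s).
  move=> b b' bb'; rewrite !FP big_seq [RHS]big_seq; apply: eq_bigr => k km.
  by apply: block_depends => e ke; apply: bb'; rewrite inE; apply: (block_sub k) => //; exact: iota_lt.
have [mF PF] := prob_bits R dd T P d w iid th F s (fun=> false) (uniq_box_edges d _) Fdep.
have E : [set om | all (fun k => has (trapped (fun e => w e om <= lev k)) (block k)) (iota a m)] =
    [set om | F (bits R dd T d w th om)].
  by apply/seteqP; split=> om /=; rewrite FE.
rewrite E; split=> //; rewrite PF lee_fin.
have pb01 := pbit01 R dd T P d w iid th.
rewrite (eq_bitE _ _ _ _ _ _ _ FP).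
rewrite (@bitE_prod R _ _ _ _ _ _ block_edge) ?iota_uniq//; first last.
- by move=> i j e _ _; exact: block_edge_disjoint.
- by move=> k _; exact: block_depends.
rewrite big_seq [X in _ <= X]big_seq; apply: ler_prod => k km.
apply/andP; split; first by apply: bitE_ge0 => // b; exact: ler0n.
rewrite (eq_bitE _ _ _ _ _ _ _ (fun b => has_prod b (block k))) bitEB bitE_cst lerD2l lerN2.
apply: le_trans (harris_prod _ _ _ pb01 _ _ _ _ _ _ _); first last.
- by move=> x b b' bb'; rewrite lerD2l lerN2 ler_nat; case tb: (trapped b x) => //;
    rewrite (_ : trapped b' x)//; move/allP: tb => tb; apply/allP => e /tb; exact: bb'.
- by move=> x b; rewrite subr_ge0; case: (trapped b x).
have q01 : 0 <= pr (lev k) ^+ (2 * d) <= 1.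
  have /andP[p0 p1] := pr01 R dd T P d w e0 iid (lev k).
  by rewrite exprn_ge0// exprn_ile1.
apply: (@le_trans _ _ (\prod_(x <- block k) (1 - pr (lev k) ^+ (2 * d)))).
  rewrite big_const_seq iter_mulr_1 count_predT.
  by rewrite ler_wiXn2l ?size_annulus// ?subr_ge0 ?lerBlDr ?lerDl; case/andP: q01.
rewrite big_seq [X in _ <= X]big_seq; apply: ler_prod => x xk.
rewrite subr_ge0; case/andP: q01 => q0 -> /=.
rewrite bitEB bitE_cst lerD2l lerN2 (eq_bitE _ _ _ _ _ _ _ (fun b => trapped_prod R d b x)).
have eb e : e \in star x -> block_edge k e by move=> ex; apply/hasP; exists x.
rewrite bitE_all_bits ?uniq_star//; last first.
  by move=> e ex; apply: (block_sub k); [exact: iota_lt|exact: eb].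
rewrite big_seq (eq_bigr (fun=> pr (lev k))); last first.
  by move=> e ex; rewrite (pbit_pr _ _ _ _ _ _ e0 iid) (thE k)//; [exact: iota_lt|exact: eb].
by rewrite -big_seq big_const_seq count_predT size_star iter_mulr_1.
Qed.

End Annuli.

Section BorelCantelli.
Variables (R : realType) (dd : measure_display) (T : measurableType dd)
  (P : probability T R).

Lemma ae_eventually_not (F : nat -> set T) (k0 : nat) :
  (forall k, measurable (F k)) ->
  (forall k, (k0 <= k)%N -> (P (F k) <= ((1 / 2) ^+ k)%:E)%E) ->
  {ae P, forall om, exists K, forall k, (K <= k)%N -> ~ F k om}.
Proof.
move=> mF PF.
pose G k := F (k0 + k)%N.
have G0 : P (lim_sup_set G) = 0%E.
  apply: lim_sup_set_cvg0 => [k|]; first exact: mF.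
  apply: le_lt_trans (_ : ((2 : R)%R%:E < +oo)%E); last exact: ltry.
  apply: le_trans (@epsilon_trick0 R 2%R xpredT (ler0n _ _)).
  apply: lee_nneseries => [k _ _|k _]; first exact: measure_ge0.
  apply: le_trans (PF _ (leq_addr _ _)) _; rewrite lee_fin.
  have -> : 2 / (2 ^ k.+1)%:R = (1 / 2) ^+ k :> R.
    by rewrite natrX exprS invfM mulrA divff // !mul1r exprVn.
  by rewrite exprD ler_piMl ?exprn_ge0 ?exprn_ile1//; lra.
exists (lim_sup_set G); split=> //.
  by apply: bigcap_measurable => // k _; apply: bigcup_measurable => j _; exact: mF.
move=> om /= H k _.
apply: contrapT => nG; apply: H; exists (k0 + k)%N => j kj Fj.
apply: nG; exists (j - k0)%N => /=; first by lia.
by rewrite /G subnKC//; lia.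
Qed.

(** Serves as second Borel-Cantelli lemma: [a / (a + b)] is the product of the factors [k / (k + 1)]
    over [a <= k < a + b], and it tends to 0 as [b] grows. *)
Lemma ae_infinitely_often (V : nat -> set T) (k0 : nat) : (0 < k0)%N ->
  (forall a b, (k0 <= a)%N ->
     measurable (\bigcap_(k in [set k | (a <= k < a + b)%N]) V k) /\
     (P (\bigcap_(k in [set k | (a <= k < a + b)%N]) V k) <= (a%:R / (a + b)%:R)%:E)%E) ->
  {ae P, forall om, forall a, exists2 k, (a <= k)%N & ~ V k om}.
Proof.
move=> k00 H; apply: ae_foralln => a0.
pose a := maxn k0 a0; have ka : (k0 <= a)%N by exact: leq_maxl.
pose N := \bigcap_(b in [set: nat]) \bigcap_(k in [set k | (a <= k < a + b)%N]) V k.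
have mN : measurable N by apply: bigcap_measurable => // b _; have [] := H a b ka.
exists N; split=> //.
- apply/eqP; rewrite eq_le measure_ge0 andbT; apply/lee_addgt0Pr => e ep; rewrite add0e.
  (* Then [a / e < b + 1 <= a + b], the last step because [a >= k0 >= 1]. *)
  pose b := Num.truncn (a%:R / e).
  have [mb Pb] := H a b ka.
  apply: (@le_trans _ _ (P (\bigcap_(k in [set k | (a <= k < a + b)%N]) V k))).
    by apply: le_measure; rewrite ?inE// => om; apply.
  apply: le_trans Pb _; rewrite lee_fin ler_pdivrMr ?ltr0n; last by lia.
  rewrite mulrC -ler_pdivrMr//.
  apply: le_trans (ltW (truncnS_gt _)) _.
  by rewrite ler_nat -/b; lia.
- move=> om /= nH b _ k /= /andP[ak _]; apply: contrapT => nV; apply: nH.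
  by exists k => //; exact: leq_trans (leq_maxr _ _) ak.
Qed.

End BorelCantelli.

(** * The speed function *)

Section SpeedFunction.
Variables (R : realType) (g : R -> R).
Hypothesis g_gt0 : forall u, 0 < u -> 0 < g u.

Lemma cvgy_le (h : R -> R) (l e : R) : h u @[u --> +oo] --> l -> l < e ->
  exists2 M, 0 < M & forall u, M <= u -> h u <= e.
Proof.
move=> /cvgrPdist_le/(_ (e - l)) H le.
have /H [M [Mr HM]] : 0 < e - l by rewrite subr_gt0.
exists (Num.max 1 (M + 1)); first by rewrite lt_max ltr01.
move=> u; rewrite ge_max => /andP[_ Mu].
have := HM u; rewrite (lt_le_trans _ Mu) ?ltrDl// => /(_ isT).
by rewrite ler_norml; lra.
Qed.

(** The common consequence of the two alternative growth assumptions on [g]; everything after this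
    section uses only this form. *)
Definition speed_decay (c u0 : R) : Prop :=
  (forall u v, u0 <= v -> v <= u -> c * (u ^+ 2 * g u) <= v ^+ 2 * g v) /\
  (forall e, 0 < e -> exists2 M, 0 < M & forall u, M <= u -> u ^+ 2 * g u <= e).

(** Put [q u = u^2 g(u)]. For [u] between [2^j v] and [2^(j+1) v], monotonicity of [g] loses only
    the factor 4 in [q u <= 4 q (2^j v) <= 4 kappa^j q v]; this is the origin of the constant
    [4^-1]. *)
Lemma doubling_decay (u0 kappa : R) :
  (forall u v, 0 < u -> u <= v -> g v <= g u) ->
  0 < u0 -> 0 < kappa < 1 ->
  (forall u, u0 <= u -> (2 * u) ^+ 2 * g (2 * u) <= kappa * (u ^+ 2 * g u)) ->
  speed_decay 4^-1 u0.
Proof.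
move=> g_mono u0p /andP[k0 k1] dbl.
pose q u := u ^+ 2 * g u.
have q0 u : 0 < u -> 0 < q u by move=> up; rewrite mulr_gt0 ?exprn_gt0// g_gt0.
have iter (j : nat) v : u0 <= v -> q (2 ^+ j * v) <= kappa ^+ j * q v.
  move=> v0; elim: j => [|j IH]; first by rewrite !expr0 !mul1r.
  have u0v : u0 <= 2 ^+ j * v.
    by rewrite (le_trans v0)// ler_peMl ?exprn_ege1 ?ler1n// (le_trans _ v0)// ltW.
  have -> : kappa ^+ j.+1 * q v = kappa * (kappa ^+ j * q v) by rewrite exprS mulrA.
  have -> : 2 ^+ j.+1 * v = 2 * (2 ^+ j * v) by rewrite exprS mulrA.
  exact: le_trans (dbl _ u0v) (ler_wpM2l (ltW k0) IH).
have H1 u v : u0 <= v -> v <= u -> 4^-1 * q u <= q v.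
  move=> v0 vu; have vp : 0 < v by exact: lt_le_trans v0.
  have up : 0 < u by exact: lt_le_trans vu.
  pose m := Num.truncn (u / v).
  have m1 : (0 < m)%N by rewrite truncn_gt0 ler_pdivlMr// mul1r.
  pose j := trunc_log 2 m.
  have /andP[jm mj] := trunc_log_bounds (ltnSn 1) m1.
  have ju : 2 ^+ j * v <= u.
    have uv : 0 <= u / v by rewrite divr_ge0// ltW.
    rewrite -ler_pdivlMr// (le_trans (_ : _ <= m%:R)) ?truncn_le//.
    by rewrite -natrX ler_nat.
  have uj : u <= 2 * (2 ^+ j * v).
    rewrite mulrA -exprS -ler_pdivrMr//.
    by rewrite (le_trans (ltW (truncnS_gt _)))// -natrX ler_nat.
  have wp : 0 < 2 ^+ j * v by rewrite mulr_gt0 ?exprn_gt0.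
  have gu := g_mono _ _ wp ju.
  have H : q u <= 4 * q (2 ^+ j * v).
    rewrite /q mulrA ler_pM ?sqr_ge0 ?(ltW (g_gt0 u up))//.
    have -> : 4 * (2 ^+ j * v) ^+ 2 = (2 * (2 ^+ j * v)) ^+ 2 by ring.
    by rewrite ler_sqr ?nnegrE ?(ltW up)// mulr_ge0// ltW.
  have := iter j v v0.
  have : kappa ^+ j * q v <= q v.
    by rewrite ler_piMl ?exprn_ile1 ?ltW// q0.
  by move: H; move: (q u) (q v) (q (2 ^+ j * v)) (kappa ^+ j * q v) => *; lra.
split=> // e e0.
have := @cvg_expr R kappa; rewrite gtr0_norm// => /(_ k1).
move=> /cvgrPdist_le/(_ (e / (4 * q u0))).
have d0 : 0 < e / (4 * q u0) by rewrite divr_gt0// mulr_gt0// q0.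
move=> /(_ d0) [j _ /(_ j (leqnn _))] /=; rewrite sub0r normrN gtr0_norm ?exprn_gt0// => Hj.
exists (2 ^+ j * u0) => [|u uj]; first by rewrite mulr_gt0 ?exprn_gt0.
have u0j : u0 <= 2 ^+ j * u0 by rewrite ler_peMl ?exprn_ege1 ?ler1n// ltW.
have h1 := H1 u (2 ^+ j * u0) u0j uj.
have h2 := iter j u0 (lexx _).
have h3 : kappa ^+ j * q u0 <= e / 4.
  have -> : e / 4 = e / (4 * q u0) * q u0 by field; rewrite gt_eqF// q0.
  by rewrite ler_wpM2r// ltW// q0.
by move: h1 h2 h3; rewrite -/(q u); move: (q u) (q (_ * _)) (_ * q u0) => *; lra.
Qed.

Lemma speed_decay_of (rho_or : (exists rho : R, rho < -2 /\ reg_var g rho) \/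
   mono_to_zero (fun u => u ^+ 2 * g u)) :
  (forall u v, 0 < u -> u <= v -> g v <= g u) ->
  exists c u0, [/\ 0 < c, 0 < u0 & speed_decay c u0].
Proof.
move=> g_mono; case: rho_or => [[rho [rho2 /(_ 2 (ltr0n _ 2))]]|[mono to0]]; last first.
  exists 1, 1; split=> //; split=> [u v v1 vu|e e0]; last exact: cvgy_le to0 e0.
  by rewrite mul1r mono// (lt_le_trans _ v1).
set A := 2 `^ (- rho).
have A4 : 4 < A.
  have -> : 4 = 2 `^ 2 :> R by rewrite powR_mulrn// -natrX.
  by rewrite /A /powR pnatr_eq0/= ltr_expR ltr_pM2r ?ln_gt0 ?ltr1n//; lra.
have A0 : 0 < A by lra.
(* [(A + 4) / 8] exceeds the limit 1 and stays below [A / 4], both because [A > 4]. The ratio of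
   [u^2 g(u)] under doubling is then at most [4 / A] times it, that is [(A + 4) / (2 A) < 1]. *)
move=> H; have [|M M0 HM] := cvgy_le _ _ ((A + 4) / 8) H; first by lra.
exists 4^-1, M; split; first by rewrite invr_gt0.
  by [].
apply: (@doubling_decay M ((A + 4) / (2 * A))) => //.
  by rewrite divr_gt0 ?mulr_gt0//=; [rewrite ltr_pdivrMr ?mulr_gt0//; lra|lra].
move=> u Mu; have up : 0 < u by exact: lt_le_trans Mu.
have := HM u Mu; rewrite (powRM _ (ler0n _ 2) (ltW up)) -/A.
have pu : 0 < u `^ (- rho) by rewrite powR_gt0.
have gu := g_gt0 _ up.
rewrite ler_pdivrMr ?mulr_gt0//.
have -> : (A + 4) / 8 * (g u * u `^ (- rho)) = ((A + 4) / 8 * g u) * u `^ (- rho) by ring.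
rewrite mulrA ler_pM2r// => h.
have -> : (A + 4) / (2 * A) * (u ^+ 2 * g u) = 4 * u ^+ 2 / A * ((A + 4) / 8 * g u).
  by field; rewrite gt_eqF.
have -> : (2 * u) ^+ 2 * g (2 * u) = 4 * u ^+ 2 / A * (g (2 * u) * A).
  by field; rewrite gt_eqF.
by rewrite ler_wpM2l// divr_ge0 ?ltW// mulr_gt0// exprn_gt0.
Qed.

End SpeedFunction.

(** Quadratic growth of the exponent keeps [log log] of the scale of order [ln k], which yields
    probabilities [1 / k], yet makes the ratio of consecutive scales exponential in [k], so inner
    boxes are negligible. The factor 4 leaves room for levels [j < k ^ 2]: [3 * j] stays below
    [4 * k ^ 2] by at least [k ^ 2]. *)
Definition scale (k : nat) : nat := (2 ^ (4 * k ^ 2))%N.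

Lemma scale_gt0 k : (0 < scale k)%N.
Proof. by rewrite expn_gt0. Qed.

Lemma scaleS k : scale k.+1 = (scale k * 2 ^ (8 * k + 4))%N.
Proof. by rewrite -expnD; congr (2 ^ _)%N; lia. Qed.

Lemma leq_scale j k : (j <= k)%N -> (scale j <= scale k)%N.
Proof. by move=> jk; rewrite leq_pexp2l// leq_mul2l /= leq_exp2r. Qed.

Lemma leq_id_scale k : (k <= scale k)%N.
Proof.
rewrite (leq_trans (ltnW (ltn_expl k (ltnSn 1))))// leq_exp2l//; nia.
Qed.

Lemma level_exponent d k : (3 <= k)%N -> (0 < d)%N ->
  (k + k * (2 * d + 1) + k.+1 * (2 * d) <= 4 * k ^ 2 * d)%N.
Proof.
move=> k3 d0; have h1 : (3 * k * (4 * d) <= k ^ 2 * (4 * d))%N by rewrite leq_mul2r expnS expn1 leq_mul2r k3 !orbT.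
have h2 : (k <= d * k)%N by rewrite leq_pmull.
have h3 : (d <= d * k)%N by rewrite leq_pmulr// (leq_trans _ k3).
by move: h1 h2 h3; rewrite (_ : 3 * k * (4 * d) = 12 * (d * k))%N; [lia|lia].
Qed.

Lemma one_minus_ge_expR (R : realType) (a : R) : 0 <= a -> a <= 1 / 2 -> expR (- (2 * a)) <= 1 - a.
Proof.
move=> a0 a2; rewrite expRN -[X in X <= _]div1r ler_pdivrMr ?expR_gt0//.
apply: (@le_trans _ _ ((1 - a) * (1 + 2 * a))); first by nra.
by rewrite ler_wpM2l ?expR_ge1Dx//; lra.
Qed.

Lemma four_sqr_le k : (2 <= k)%N -> (4 * k ^ 2 <= k ^ 4)%N.
Proof.
move=> k2; rewrite (expnD k 2 2) leq_mul2r; apply/orP; right.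
by rewrite (_ : 4 = 2 ^ 2)%N// leq_exp2r.
Qed.

Lemma scale_ratio (R : realType) (a b y : R) (n : nat) : y != 0 ->
  (5 * a) ^+ n * b = (5 / y) ^+ n * ((a * y) ^+ n * b).
Proof. by move=> y0; rewrite mulrA -exprMn; congr (_ ^+ n * b); field. Qed.

Lemma expr_swap (R : realType) (x a : R) (n : nat) : x != 0 ->
  (x * a ^+ (n + 1)) ^+ n = (x * a ^+ n) ^+ (n + 1) / x.
Proof.
move=> x0; rewrite !exprMn -!exprM (mulnC n) (addn1 n) (exprS x n).
by rewrite mulrAC [x * _]mulrC mulfK.
Qed.

Lemma mulr_cancel4 (R : realType) (a e l : R) : a != 0 ->
  a * (e / (4 * a) * (4 * l)) = e * l.
Proof. by move=> a0; field. Qed.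

Lemma half_ge0 (R : realType) : 0 <= 1 / 2 :> R.
Proof. by lra. Qed.

Lemma half_le1 (R : realType) : 1 / 2 <= 1 :> R.
Proof. by lra. Qed.

Lemma mulr_shuffle (R : realType) (a b x y z : R) :
  a * b * x * (y * z) = a * y * b * (x * z).
Proof. by ring. Qed.

Lemma expr2B (R : realType) (m n : nat) : (n <= m)%N ->
  2 ^+ (m - n) = 2 ^+ m / 2 ^+ n :> R.
Proof.
by move=> nm; rewrite -{2}(subnK nm) exprD mulfK// expf_neq0// pnatr_eq0.
Qed.

Section ScaleLemmas.
Variable R : realType.
Local Notation N k := ((scale k)%:R : R).

Lemma scaleR k : N k = 2 ^+ (4 * k ^ 2).
Proof. by rewrite natrX. Qed.

Lemma ln_le_id (y : R) : 0 < y -> ln y <= y.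
Proof. by move=> y0; have := expR_ge1Dx (ln y); rewrite lnK ?posrE//; lra. Qed.

Lemma near_le_pow2 (B : R) : \forall k \near \oo, B <= 2 ^+ k.
Proof.
exists (Num.truncn B).+1 => // k /= Bk; apply: le_trans (ltW (truncnS_gt _)) _.
rewrite -natrX ler_nat (leq_trans Bk)// ltnW// ltn_expl//.
Qed.

Lemma near_succ (Q : nat -> Prop) :
  (\forall k \near \oo, Q k) -> \forall k \near \oo, Q k.+1.
Proof. by move=> [K _ H]; exists K => // k /= Kk; apply: H => /=; exact: leqW. Qed.

Lemma near_ge_scale (M : R) : \forall k \near \oo, M <= N k.
Proof.
near=> k; rewrite (@le_trans _ _ k%:R)//; first by near: k; exact: nbhs_infty_ger.
by rewrite ler_nat leq_id_scale.
Unshelve. all: by end_near. Qed.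

Lemma ln_nat_le (k : nat) : (0 < k)%N -> ln (k%:R : R) <= k%:R.
Proof. by move=> k0; apply: ln_le_id; rewrite ltr0n. Qed.

Lemma expr_half_nat (k : nat) : (1 / 2) ^+ k = (2 ^+ k)^-1 :> R.
Proof. by rewrite expr_div_n expr1n div1r. Qed.

Lemma expR_decay (x : R) (q : nat) : 0 < x -> (0 < q)%N -> expR (- x) <= (q%:R / x) ^+ q.
Proof.
move=> x0 q0; have qr : 0 < q%:R :> R by rewrite ltr0n.
rewrite expRN -[X in _ <= X]invrK lef_pV2 ?posrE ?expR_gt0 ?invr_gt0 ?exprn_gt0 ?divr_gt0//.
rewrite -exprVn invf_div.
have -> : x = q%:R * (x / q%:R) by field; rewrite gt_eqF.
rewrite expRM_natl {1}(_ : q%:R * (x / q%:R) / q%:R = x / q%:R); last by field; rewrite gt_eqF.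
rewrite lerXn2r ?nnegrE ?(ltW (expR_gt0 _)) ?divr_ge0 ?(ltW x0)//.
by have := expR_ge1Dx (x / q%:R); lra.
Qed.

(** Let [sigma = N 2^(-3j)]. Since the exponent is at most [5 N], the numerator is at most
    [exp(sigma / 4)], while [2^(-sigma) <= exp(-sigma / 2)]. The remaining [exp(-sigma / 4)] beats
    any power of [sigma], and [sigma >= 2^(k^2)] because [j < k^2]. *)
Lemma line_term_bound (b : R) (k j q : nat) : 0 <= b -> b <= (1 / 2) ^+ (3 * j) / 20 ->
  (j < k ^ 2)%N -> (0 < q)%N ->
  (1 + b) ^+ (2 * (2 * scale k) + 1) / 2 ^+ (2 ^ (4 * k ^ 2 - 3 * j)) <=
  (4 * q%:R) ^+ q * (1 / 2) ^+ (q * k ^ 2).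
Proof.
move=> b0 bj jk q0.
set sg := (2 ^ (4 * k ^ 2 - 3 * j))%N.
have sgR : sg%:R = N k * (1 / 2) ^+ (3 * j) :> R.
  rewrite /sg natrX scaleR expr_half_nat expr2B//; nia.
have Nb : (2 * (2 * scale k) + 1)%:R * b <= sg%:R / 4.
  apply: (@le_trans _ _ ((5 * N k) * ((1 / 2) ^+ (3 * j) / 20))).
    apply: ler_pM => //; rewrite ?ler0n// -natrM ler_nat.
    by have := scale_gt0 k; lia.
  by rewrite sgR; move: (N k) ((1 / 2) ^+ _) => x y; lra.
have h1 : (1 + b) ^+ (2 * (2 * scale k) + 1) <= expR (sg%:R / 4).
  apply: (@le_trans _ _ (expR b ^+ (2 * (2 * scale k) + 1))).
    by rewrite lerXn2r ?nnegrE ?(ltW (expR_gt0 _)) ?expR_ge1Dx// addr_ge0.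
  by rewrite -expRM_natl ler_expR.
have h2 : (2 ^+ sg)^-1 <= expR (- (sg%:R / 2)) :> R.
  have -> : - (sg%:R / 2) = sg%:R * (- 2^-1) :> R by rewrite mulrN.
  rewrite expRM_natl -exprVn lerXn2r ?nnegrE ?(ltW (expR_gt0 _)) ?invr_ge0//.
  by have := expR_ge1Dx (- 2^-1 : R); lra.
apply: (@le_trans _ _ (expR (- (sg%:R / 4)))).
  apply: (@le_trans _ _ (expR (sg%:R / 4) * expR (- (sg%:R / 2)))).
    by apply: ler_pM => //; rewrite ?exprn_ge0 ?addr_ge0 ?invr_ge0 ?exprn_ge0.
  by rewrite -expRD ler_expR; lra.
have sg0 : 0 < sg%:R :> R by rewrite ltr0n expn_gt0.
have sgk : 2 ^+ (k ^ 2) <= sg%:R :> R by rewrite /sg natrX ler_eXn2l ?ltr1n//; lia.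
apply: le_trans (expR_decay _ q _ q0) _; first by rewrite divr_gt0.
rewrite mulnC exprM -exprMn lerXn2r ?nnegrE ?divr_ge0 ?mulr_ge0 ?exprn_ge0 ?ler0n ?(ltW sg0)//.
rewrite invf_div mulrA [q%:R * 4]mulrC ler_wpM2l ?mulr_ge0 ?ler0n//.
by rewrite expr_half_nat lef_pV2 ?posrE ?exprn_gt0.
Qed.

End ScaleLemmas.

(** * Failure probabilities along the scales *)

Section DyadicBounds.
Variables (R : realType) (d : nat) (p g : R -> R).
Hypothesis d2 : (2 <= d)%N.
Hypothesis p01 : forall s, 0 <= p s <= 1.
Hypothesis small : forall e, 0 < e -> exists2 M, 0 < M &
  forall u, M <= u -> u ^+ d * p (g u) ^+ (2 * d) <= e * ln (ln u).
Local Notation N k := ((scale k)%:R : R).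

(** A crude form of [small]: bounding [ln (ln u)] by [u] and using [d >= 2] leaves
    [p (g u) ^+ (2 * d)] at most [u^(1 - d) <= 1 / u]. *)
Lemma prob_dyadic : exists j1, forall j, (j1 <= j)%N ->
  p (g (2 ^+ j)) ^+ (2 * d) <= (1 / 2) ^+ j.
Proof.
have [M M0 HM] := small 1 ltr01.
have [j1 _ Hj1] := near_le_pow2 R M.
exists (maxn 1 j1) => j; rewrite geq_max => /andP[j0 /Hj1 /= Mj].
have := HM _ Mj; rewrite mul1r.
have lnj : 0 < ln (2 ^+ j : R) by rewrite ln_gt0// exprn_egt1 ?ltr1n// -lt0n.
have : ln (ln (2 ^+ j)) <= 2 ^+ j :> R.
  apply: le_trans (ln_le_id _ _ lnj) _; apply: ln_le_id; by rewrite exprn_gt0.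
move=> h /le_trans /(_ h) {}h.
have p0 : 0 <= p (g (2 ^+ j)) ^+ (2 * d) by rewrite exprn_ge0//; case/andP: (p01 (g (2 ^+ j))).
have Y1 : 0 < (2 : R) ^+ j by rewrite exprn_gt0.
rewrite expr_div_n expr1n ler_pdivlMr//.
have h2 : (2 ^+ j) ^+ 2 * p (g (2 ^+ j)) ^+ (2 * d) <= 2 ^+ j.
  apply: le_trans h; rewrite ler_wpM2r// ler_weXn2l//.
  by rewrite exprn_ege1// ler1n.
rewrite -(ler_pM2l Y1) mulr1; apply: le_trans h2.
by rewrite expr2 -mulrA [X in _ * X]mulrC.
Qed.

Lemma card_box2 (k : nat) : ((2 * (2 * scale k) + 1) ^ d)%:R <= 5 ^+ d * N k ^+ d :> R.
Proof.
rewrite -exprMn natrX lerXn2r ?nnegrE ?ler0n ?mulr_ge0// -natrM ler_nat.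
by have := scale_gt0 k; lia.
Qed.

(** At scale [k] there are about [2^(4 d k^2)] balls, and [prob_dyadic] gives each a failure
    probability of order [2^(-h k^2)]; hence the lower bound on [h]. *)
Lemma top_bound (B : R) (h : nat) : 0 < B -> (4 * d + 4 <= h)%N -> \forall k \near \oo,
  ((2 * (2 * scale k.+1) + 1) ^ d)%:R * (B * p (g (2 ^+ (k.+1 ^ 2))) ^+ (2 * d * h)) <= (1 / 2) ^+ k.+2.
Proof.
move=> B0 dh; have [j1 Hj] := prob_dyadic.
apply: (near_succ (fun k => ((2 * (2 * scale k) + 1) ^ d)%:R *
  (B * p (g (2 ^+ (k ^ 2))) ^+ (2 * d * h)) <= (1 / 2) ^+ k.+1)).
near=> k.
have kj : (maxn 3 j1 <= k)%N by near: k; exact: nbhs_infty_ge.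
move: kj; rewrite geq_max => /andP[k3 kj].
have Bk : 5 ^+ d * B <= 2 ^+ k by near: k; exact: near_le_pow2.
have jk : (j1 <= k ^ 2)%N by nia.
have := Hj _ jk; set a := p _ => ha.
have a0 : 0 <= a by case/andP: (p01 (g (2 ^+ (k ^ 2)))).
have ha2 : a ^+ (2 * d * h) <= (1 / 2) ^+ (k ^ 2 * (4 * d + 4)).
  rewrite exprM [X in _ <= X]exprM.
  apply: (@le_trans _ _ (((1 / 2) ^+ (k ^ 2)) ^+ h)).
    by rewrite lerXn2r ?nnegrE ?exprn_ge0//; lra.
  by rewrite ler_wiXn2l ?exprn_ge0 ?exprn_ile1//; lra.
apply: (@le_trans _ _ (2 ^+ k * (N k ^+ d * (1 / 2) ^+ (k ^ 2 * (4 * d + 4))))).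
  apply: (@le_trans _ _ (5 ^+ d * N k ^+ d * (B * a ^+ (2 * d * h)))).
    by rewrite ler_wpM2r ?card_box2// mulr_ge0 ?exprn_ge0// ltW.
  have -> : 5 ^+ d * N k ^+ d * (B * a ^+ (2 * d * h)) = (5 ^+ d * B) * (N k ^+ d * a ^+ (2 * d * h)) by ring.
  have N0 : 0 <= N k ^+ d by rewrite exprn_ge0// ler0n.
  apply: ler_pM => //; rewrite ?mulr_ge0 ?exprn_ge0 ?(ltW B0)//.
  by rewrite ler_wpM2l.
rewrite scaleR -exprM mulrA -exprD !expr_half_nat.
rewrite ler_pdivrMr ?exprn_gt0// mulrC ler_pdivlMr ?exprn_gt0//.
by rewrite -exprD ler_eXn2l ?ltr1n//; nia.
Unshelve. all: by end_near. Qed.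

Lemma lines_bound (B D : R) (m j0 : nat) : 0 < B -> 0 <= D ->
  (forall j, (j0 <= j)%N -> B * p (g (2 ^+ j)) ^+ m <= (1 / 2) ^+ (3 * j) / 20) ->
  \forall k \near \oo,
  \sum_(j0 <= j < k.+1 ^ 2) ((2 * scale k.+1 + 1) ^ d)%:R * D *
   ((1 + B * p (g (2 ^+ j)) ^+ m) ^+ (2 * (2 * scale k.+1) + 1) /
      2 ^+ (2 ^ (4 * k.+1 ^ 2 - 3 * j))) <= (1 / 2) ^+ k.+2.
Proof.
move=> B0 D0 Bj.
apply: (near_succ (fun k => \sum_(j0 <= j < k ^ 2) ((2 * scale k + 1) ^ d)%:R * D *
   ((1 + B * p (g (2 ^+ j)) ^+ m) ^+ (2 * (2 * scale k) + 1) /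
      2 ^+ (2 ^ (4 * k ^ 2 - 3 * j))) <= (1 / 2) ^+ k.+1)).
(* [4 d] cancels the [2^(4 d k^2)] starting points of lines; of the two spare factors [2^(-k^2)],
   one pays for the number of levels and the other gives the decay. *)
pose q := (4 * d + 2)%N; have q0 : (0 < q)%N by rewrite /q; lia.
pose E : R := 3 ^+ d * D * (4 * q%:R) ^+ q.
have E0 : 0 <= E by rewrite !mulr_ge0 ?exprn_ge0 ?mulr_ge0 ?ler0n.
near=> k.
have k3 : (3 <= k)%N by near: k; exact: nbhs_infty_ge.
have Ek : E <= 2 ^+ k by near: k; exact: near_le_pow2.
have N0 : 0 <= N k ^+ d by rewrite exprn_ge0// ler0n.
pose X : R := N k ^+ d * (1 / 2) ^+ (q * k ^ 2).
have X0 : 0 <= X by rewrite mulr_ge0 ?exprn_ge0//; lra.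
apply: (@le_trans _ _ (\sum_(j0 <= j < k ^ 2) E * X)).
  rewrite !big_nat; apply: ler_sum => j /andP[jj jk].
  have -> : E * X = (3 ^+ d * N k ^+ d * D) * ((4 * q%:R) ^+ q * (1 / 2) ^+ (q * k ^ 2)).
    exact: mulr_shuffle.
  have p0 : 0 <= p (g (2 ^+ j)) by case/andP: (p01 (g (2 ^+ j))).
  have Bp0 : 0 <= B * p (g (2 ^+ j)) ^+ m by rewrite mulr_ge0 ?exprn_ge0// ltW.
  apply: ler_pM => //.
  - by rewrite mulr_ge0 ?ler0n.
  - by rewrite divr_ge0 ?exprn_ge0 ?addr_ge0.
  - rewrite ler_wpM2r// -exprMn natrX lerXn2r ?nnegrE ?ler0n ?mulr_ge0// -natrM ler_nat.
    by have := scale_gt0 k; lia.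
  - by apply: line_term_bound => //; exact: Bj.
rewrite sumr_const_nat.
apply: (@le_trans _ _ ((k ^ 2)%:R * (2 ^+ k * X))).
  rewrite -[X in X <= _]mulr_natl; apply: ler_pM; rewrite ?ler0n ?mulr_ge0//.
    by rewrite ler_nat leq_subr.
  by rewrite ler_wpM2r.
apply: (@le_trans _ _ (2 ^+ (k ^ 2) * (2 ^+ k * X))).
  by rewrite ler_wpM2r ?mulr_ge0 ?exprn_ge0// -natrX ler_nat ltnW// ltn_expl.
rewrite /X scaleR -exprM !expr_half_nat mulrA mulrA -!exprD.
rewrite ler_pdivrMr ?exprn_gt0// mulrC ler_pdivlMr ?exprn_gt0// -exprD ler_eXn2l ?ltr1n//.
by rewrite /q; nia.
Unshelve. all: by end_near. Qed.

End DyadicBounds.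

Section LevelBounds.
Variables (R : realType) (d : nat) (p g : R -> R) (c u0 : R).
Hypothesis d2 : (2 <= d)%N.
Hypothesis p01 : forall s, 0 <= p s <= 1.
Hypothesis p_mono : forall s s', s <= s' -> p s <= p s'.
Hypothesis g_gt0 : forall u, 0 < u -> 0 < g u.
Hypothesis c_gt0 : 0 < c.
Hypothesis u0_gt0 : 0 < u0.
Hypothesis decay : speed_decay R g c u0.
Hypothesis small : forall e, 0 < e -> exists2 M, 0 < M &
  forall u, M <= u -> u ^+ d * p (g u) ^+ (2 * d) <= e * ln (ln u).
Local Notation N k := ((scale k)%:R : R).

(** Replacing [C g(N)] by [g(N / A)] costs only a factor [A^d], and [ln (ln N) <= ln (k^4)] turns
    smallness against [log log] into smallness against [ln k]. *)
Lemma prob_level (C e : R) : 0 < C -> 0 < e ->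
  \forall k \near \oo, N k ^+ d * p (C * g (N k)) ^+ (2 * d) <= e * ln k%:R.
Proof.
move=> C0 e0; have [dec _] := decay.
(* [A >= 1] and [A >= C / c] together give [C <= c A^2], as required when [decay] is applied between
   [N / A] and [N]. *)
pose A := Num.max 1 (C / c).
have A1 : 1 <= A by rewrite le_max lexx.
have A0 : 0 < A by exact: lt_le_trans A1.
have AC : C <= c * A ^+ 2.
  have : C / c <= A by rewrite le_max lexx orbT.
  rewrite ler_pdivrMr// mulrC => /le_trans; apply; rewrite ler_pM2l//.
  by rewrite expr2 ler_peMl// ltW.
have e'0 : 0 < e / (4 * A ^+ d) by rewrite divr_gt0// mulr_gt0// exprn_gt0.
have [M M0 HM] := small _ e'0.
near=> k.
have k2 : (2 <= k)%N by near: k; exact: nbhs_infty_ge.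
pose u := N k / A.
have big : (Num.max (Num.max M u0) (expR 1)) * A <= N k by near: k; exact: near_ge_scale.
have uM : Num.max (Num.max M u0) (expR 1) <= u by rewrite ler_pdivlMr.
move: uM; rewrite !ge_max => /andP[/andP[uM uu0] ue].
have up : 0 < u by exact: lt_le_trans uu0.
have Nu : N k = A * u by rewrite /u mulrC divfK// gt_eqF.
have uN : u <= N k by rewrite Nu ler_peMl// ltW.
have gC : C * g (N k) <= g u.
  have := dec _ _ uu0 uN; rewrite {1}Nu exprMn => h.
  have {}h : u ^+ 2 * (c * A ^+ 2 * g (N k)) <= u ^+ 2 * g u by move: h; lra.
  move: h; rewrite ler_pM2l ?exprn_gt0// => h; apply: le_trans h.
  by rewrite ler_wpM2r// ltW// g_gt0// (lt_le_trans up).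
have p0 s : 0 <= p s by case/andP: (p01 s).
have h1 : p (C * g (N k)) ^+ (2 * d) <= p (g u) ^+ (2 * d).
  by rewrite lerXn2r ?nnegrE// p_mono.
have lnu : 1 <= ln u by rewrite -(expRK 1) ler_ln ?posrE ?expR_gt0.
have ll : ln (ln u) <= 4 * ln k%:R.
  have lnN : ln (N k) <= k%:R ^+ 4.
    have l2 : ln 2 <= 1 :> R by have := expR_ge1Dx (ln 2 : R); rewrite lnK ?posrE//; lra.
    rewrite scaleR lnXn// (@le_trans _ _ (4 * k ^ 2)%:R)//.
      by rewrite -[X in X <= _]mulr_natr ler_piMl ?ler0n.
    by rewrite -natrX ler_nat four_sqr_le.
  have -> : 4 * ln k%:R = ln (k%:R ^+ 4) :> R by rewrite lnXn ?mulr_natl// ltr0n (ltnW k2).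
  rewrite ler_ln ?posrE ?exprn_gt0 ?ltr0n//; last 2 first.
  - exact: lt_le_trans lnu.
  - exact: ltnW k2.
  by apply: le_trans lnN; rewrite ler_ln ?posrE// (lt_le_trans up).
rewrite Nu exprMn -mulrA.
apply: (@le_trans _ _ (A ^+ d * (u ^+ d * p (g u) ^+ (2 * d)))).
  by rewrite ler_wpM2l ?exprn_ge0 ?(ltW A0)// -Nu ler_wpM2l// exprn_ge0// ltW.
apply: (@le_trans _ _ (A ^+ d * (e / (4 * A ^+ d) * (4 * ln k%:R)))).
  rewrite ler_wpM2l ?exprn_ge0 ?(ltW A0)//.
  by apply: le_trans (HM u uM) _; rewrite ler_wpM2l// ltW.
by rewrite mulr_cancel4// expf_neq0// gt_eqF.
Unshelve. all: by end_near. Qed.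

(** The same count over the box of scale [k + 1] is at most [ln (k + 1)]; passing to the inner box
    divides it by about [2^((8 k + 4) d)]. *)
Lemma inner_bound (C : R) : 0 < C -> \forall k \near \oo,
  ((2 * (scale k).+1 + 1) ^ d)%:R * p (C * g (N k.+1)) ^+ (2 * d) <= (1 / 2) ^+ k.+2.
Proof.
move=> C0; have level := near_succ _ (prob_level C 1 C0 ltr01); near=> k.
have k1 : (1 <= k)%N by near: k; exact: nbhs_infty_ge.
have := ln_nat_le R k.+1 (ltn0Sn k).
have : N k.+1 ^+ d * p (C * g (N k.+1)) ^+ (2 * d) <= 1 * ln k.+1%:R by near: k; exact: level.
rewrite mul1r; move=> h0 /(le_trans h0) h; clear h0.
set a := p _ ^+ _ in h *.
have a0 : 0 <= a by rewrite exprn_ge0//; case/andP: (p01 (C * g (N k.+1))).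
have s1 := scale_gt0 k.
apply: (@le_trans _ _ ((5 * N k) ^+ d * a)).
  by rewrite ler_wpM2r// natrX lerXn2r ?nnegrE ?ler0n ?mulr_ge0// -natrM ler_nat; lia.
pose y : R := 2 ^+ (8 * k + 4).
have y0 : 0 < y by rewrite exprn_gt0.
have E : (5 * N k) ^+ d * a = (5 / y) ^+ d * (N k.+1 ^+ d * a).
  by rewrite scaleS natrM natrX -/y; apply: scale_ratio; rewrite gt_eqF.
have y5 : 5 / y <= (1 / 2) ^+ (8 * k + 1).
  rewrite expr_half_nat ler_pdivrMr// mulrC ler_pdivlMr ?exprn_gt0//.
  rewrite /y (_ : 8 * k + 4 = 3 + (8 * k + 1))%N; last by lia.
  by rewrite [X in _ <= X]exprD ler_wpM2r ?exprn_ge0// -natrX ler_nat.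
have yd : (5 / y) ^+ d <= (1 / 2) ^+ (8 * k + 1).
  apply: le_trans (_ : (5 / y) ^+ 1 <= _); last by rewrite expr1.
  rewrite ler_wiXn2l ?divr_ge0 ?(ltW y0)//; last by lia.
  by rewrite (le_trans y5)// exprn_ile1 ?half_ge0 ?half_le1.
have kk : k.+1%:R <= 2 ^+ k :> R by rewrite -natrX ler_nat ltn_expl.
rewrite E; apply: (@le_trans _ _ ((1 / 2) ^+ (8 * k + 1) * 2 ^+ k)).
  apply: ler_pM => //; last exact: le_trans h kk.
    by rewrite exprn_ge0// divr_ge0// ltW.
  by rewrite mulr_ge0// exprn_ge0// ler0n.
rewrite !expr_half_nat mulrC ler_pdivrMr ?exprn_gt0// mulrC ler_pdivlMr ?exprn_gt0//.
by rewrite -exprD ler_eXn2l ?ltr1n//; lia.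
Unshelve. all: by end_near. Qed.

(** With [x = N^d] and [a] the probability of a bad edge, [x a^(2d) <= k]. By [expr_swap],
    [x a^(2d+1)] raised to the power [2d] is at most [k^(2d+1) / x]: one bad edge more gains a power
    of [N]. Comparing [2d]-th powers avoids fractional exponents. *)
Lemma level_bound (C B : R) : 0 < C -> 0 < B -> \forall k \near \oo,
  ((2 * (2 * scale k.+1) + 1) ^ d)%:R * (B * p (C * g (N k.+1)) ^+ (2 * d + 1)) <= (1 / 2) ^+ k.+2.
Proof.
move=> C0 B0; have level := prob_level C 1 C0 ltr01.
apply: (near_succ (fun k => ((2 * (2 * scale k) + 1) ^ d)%:R *
  (B * p (C * g (N k)) ^+ (2 * d + 1)) <= (1 / 2) ^+ k.+1)).
near=> k.
have k3 : (3 <= k)%N by near: k; exact: nbhs_infty_ge.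
have := ln_nat_le R k (ltnW (ltnW k3)).
have : N k ^+ d * p (C * g (N k)) ^+ (2 * d) <= 1 * ln k%:R by near: k; exact: level.
rewrite mul1r; move=> h0 /(le_trans h0) h; clear h0.
have Bk : (5 ^+ d * B) ^+ (2 * d) <= 2 ^+ k by near: k; exact: near_le_pow2.
set a := p _ in h *.
have a0 : 0 <= a by case/andP: (p01 (C * g (N k))).
set B' := 5 ^+ d * B in Bk.
have B'0 : 0 < B' by rewrite mulr_gt0// exprn_gt0.
set x := N k ^+ d in h.
have x0 : 0 < x by rewrite exprn_gt0// ltr0n scale_gt0.
apply: (@le_trans _ _ (B' * (x * a ^+ (2 * d + 1)))).
  have -> : B' * (x * a ^+ (2 * d + 1)) = 5 ^+ d * x * (B * a ^+ (2 * d + 1)) by rewrite /B'; ring.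
  by rewrite ler_wpM2r ?card_box2// mulr_ge0 ?exprn_ge0// ltW.
have dd0 : (0 < 2 * d)%N by lia.
have xa0 : 0 <= x * a ^+ (2 * d + 1) by rewrite mulr_ge0 ?(ltW x0)// exprn_ge0.
rewrite -(@ler_pXn2r _ (2 * d))// ?nnegrE ?exprn_ge0 ?half_ge0//; last first.
  exact: mulr_ge0 (ltW B'0) xa0.
rewrite exprMn.
have -> : (x * a ^+ (2 * d + 1)) ^+ (2 * d) = (x * a ^+ (2 * d)) ^+ (2 * d + 1) / x.
  by apply: expr_swap; rewrite gt_eqF.
have kk : k%:R <= 2 ^+ k :> R by rewrite -natrX ler_nat ltnW// ltn_expl.
have h2 : (x * a ^+ (2 * d)) ^+ (2 * d + 1) <= 2 ^+ (k * (2 * d + 1)).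
  rewrite [X in _ <= X]exprM lerXn2r ?nnegrE ?exprn_ge0 ?mulr_ge0 ?exprn_ge0 ?(ltW x0)//.
  exact: le_trans h kk.
rewrite expr_half_nat exprVn -exprM mulrA ler_pdivrMr// [X in _ <= X]mulrC ler_pdivlMr ?exprn_gt0//.
apply: (@le_trans _ _ (2 ^+ k * 2 ^+ (k * (2 * d + 1)) * 2 ^+ (k.+1 * (2 * d)))).
  rewrite ler_wpM2r ?exprn_ge0//; apply: ler_pM => //.
    exact: exprn_ge0 (ltW B'0).
  by rewrite exprn_ge0// mulr_ge0 ?exprn_ge0 ?(ltW x0).
by rewrite /x scaleR -exprM -!exprD ler_eXn2l ?ltr1n// level_exponent// ltnW.
Unshelve. all: by end_near. Qed.

(** With [a] the trapping probability and [L <= 3^d N^d] vertices, [(1 - a)^L >= exp(-2 a L)].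
    Taking [prob_level] with constant [1 / (2 * 3^d)] makes [2 a L <= ln k], so this is at least
    [1 / k]. *)
Lemma no_trap_bound (C : R) : 0 < C -> \forall k \near \oo,
  1 - (1 - p (C * g (N k.+1)) ^+ (2 * d)) ^+ ((2 * scale k.+1 + 1) ^ d) <= k%:R / k.+1%:R.
Proof.
move=> C0; have e0 : 0 < (2 * 3 ^+ d)^-1 :> R by rewrite invr_gt0 mulr_gt0// exprn_gt0.
have level := prob_level C _ C0 e0.
suff H : \forall k \near \oo, (k%:R)^-1 <=
    (1 - p (C * g (N k)) ^+ (2 * d)) ^+ ((2 * scale k + 1) ^ d).
  have := near_succ _ H; apply: filterS => k.
  have -> : k%:R / k.+1%:R = 1 - (k.+1%:R)^-1 :> R.
    by rewrite -[k.+1]addn1 natrD; field; rewrite natr1 pnatr_eq0.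
  by move=> h; rewrite lerD2l lerN2.
near=> k.
have k1 : (2 <= k)%N by near: k; exact: nbhs_infty_ge.
have kr : 0 < k%:R :> R by rewrite ltr0n ltnW.
have : N k ^+ d * p (C * g (N k)) ^+ (2 * d) <= (2 * 3 ^+ d)^-1 * ln k%:R by near: k; exact: level.
set a := p _ ^+ _ => h.
have a0 : 0 <= a by rewrite exprn_ge0//; case/andP: (p01 (C * g (N k))).
have N1 : 1 <= N k by rewrite ler1n scale_gt0.
pose L : R := ((2 * scale k + 1) ^ d)%:R.
have L0 : 0 <= L by exact: ler0n.
have LN : L <= 3 ^+ d * N k ^+ d.
  rewrite /L -exprMn natrX lerXn2r ?nnegrE ?ler0n ?mulr_ge0// -natrM ler_nat.
  by have := scale_gt0 k; lia.
have lnk := ln_nat_le R k (ltnW k1).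
have aL : 2 * (a * L) <= ln k%:R.
  apply: (@le_trans _ _ (2 * 3 ^+ d * (N k ^+ d * a))).
    rewrite -mulrA ler_wpM2l// mulrA mulrC; exact: ler_wpM2r.
  rewrite -ler_pdivlMl// mulr_gt0// exprn_gt0//.
have a2 : a <= 1 / 2.
  have T1 : 1 <= 3 ^+ d :> R by rewrite exprn_ege1// ler1n.
  have Nk : k%:R <= N k ^+ d.
    apply: (@le_trans _ _ (N k)); last by rewrite -{1}(expr1 (N k)) ler_weXn2l// ltnW.
    by rewrite ler_nat leq_id_scale.
  have Np : 0 < N k ^+ d by exact: lt_le_trans Nk.
  rewrite -(ler_pM2l Np); apply: le_trans h _.
  apply: (@le_trans _ _ (1 / 2 * ln k%:R)).
    rewrite ler_wpM2r ?ln_ge0 ?ler1n ?(ltnW k1)//.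
    rewrite div1r lef_pV2 ?posrE//; first by rewrite ler_peMr.
  rewrite mulrC ler_wpM2r//; exact: le_trans lnk Nk.
have h1 := one_minus_ge_expR _ _ a0 a2.
apply: (@le_trans _ _ (expR (- (2 * a)) ^+ ((2 * scale k + 1) ^ d))).
  rewrite -expRM_natl -/L.
  have -> : (k%:R)^-1 = expR (- ln k%:R) :> R by rewrite expRN lnK ?posrE.
  by rewrite ler_expR mulrN lerN2 mulrC -mulrA.
have e1 : 0 <= expR (- (2 * a)) by exact: ltW (expR_gt0 _).
by rewrite lerXn2r ?nnegrE// (le_trans e1).
Unshelve. all: by end_near. Qed.

End LevelBounds.

(** * Proof of the theorem *)

Lemma lambda1_ge (R : realType) (d : nat) (W : edge d -> R) (n : nat) (K : R) :
  (forall e, 0 < W e) -> 0 < K ->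
  (forall f : pt d -> R, (forall x, ~ inbox n x -> f x = 0) ->
     \sum_(k : {ffun 'I_d -> 'I_(2 * n + 1)}) f (boxpt k) ^+ 2 <= K * local_energy W n.+1 f 0) ->
  (2 * K)^-1 <= lambda1 W n.
Proof.
move=> W0 K0 H; apply: lb_le_inf.
  (* The indicator of the origin is admissible, so the infimum is over a nonempty set; a lower bound
     passes to [inf] only then. *)
  pose f (x : pt d) : R := (x == 0)%:R.
  have z0 : inbox n (0 : pt d) by move=> j; rewrite mxE.
  have [k0 k0E] := inbox_ex d n 0 z0.
  exists (dirichlet W n f); exists f => //; split=> [x nx|].
    by rewrite /f; case: eqP => // x0; case: nx; rewrite x0.
  rewrite (bigD1 k0)//= -k0E /f eqxx expr1n big1 ?addr0// => k kk0.
  rewrite k0E; case: eqP => [/boxpt_inj kE|_]; last by rewrite expr0n.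
  by rewrite kE eqxx in kk0.
move=> _ [f [f0 f1] <-].
have := H f f0; rewrite f1 => h.
have := dirichlet_ge R d W n f (fun e => ltW (W0 e)).
move: (local_energy _ _ _ _) (dirichlet _ _ _) h => E D h ED.
rewrite -[X in X <= _]mul1r ler_pdivrMr ?mulr_gt0//.
have : K * E <= K * (2 * D) by rewrite ler_pM2l//; lra.
by lra.
Qed.

Lemma sum_half_geometric (R : realType) (a b : nat) :
  \sum_(a <= j < b) (1 / 2) ^+ j <= 2 * (1 / 2) ^+ a :> R.
Proof.
have [ab|ba] := leqP a b; last by rewrite big_geq ?mulr_ge0 ?exprn_ge0 ?half_ge0// ltnW.
suff : \sum_(a <= j < b) (1 / 2) ^+ j <= 2 * (1 / 2) ^+ a - 2 * (1 / 2) ^+ b :> R.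
  by move/le_trans; apply; rewrite gerBl mulr_ge0 ?exprn_ge0 ?half_ge0.
elim: b ab => [|b IH]; first by rewrite leqn0 => /eqP ->; rewrite big_geq// subrr.
rewrite leq_eqVlt => /predU1P[->|ab]; first by rewrite big_geq// subrr.
rewrite big_nat_recr//= [X in _ - 2 * X]exprS.
by have := IH ab; move: (\sum_(a <= i < b) _) ((1 / 2) ^+ a) ((1 / 2) ^+ b) => x y z; lra.
Qed.

Lemma expr_half_cube (R : realType) (j : nat) :
  (1 / 2) ^+ (3 * j) = (1 / 2) ^+ j * ((2 ^+ j) ^+ 2)^-1 :> R.
Proof.
by rewrite mulnC exprM (exprS _ 2) [in LHS]expr_half_nat exprVn expr_half_nat.
Qed.

(** * Deterministic estimate at a good scale *)

Section GoodScale.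
Variables (R : realType) (d : nat) (g : R -> R) (c u0 : R) (W : edge d -> R) (i0 : 'I_d).
Variables (m n j0 J : nat) (t : R).
Hypothesis d2 : (2 <= d)%N.
Hypothesis g_gt0 : forall u, 0 < u -> 0 < g u.
Hypothesis c_gt0 : 0 < c.
Hypothesis decay : speed_decay R g c u0.
Hypothesis W_gt0 : forall e, 0 < W e.
Hypothesis t_gt0 : 0 < t.
Hypothesis dm : (2 * d < m)%N.
Local Notation r := (2 * m + 1)%N.
Hypothesis rn : (r + 2 <= n)%N.
Hypothesis u0j : u0 <= 2 ^+ j0.
Hypothesis jJ : (j0 <= J)%N.
Hypothesis Jn : 2 ^+ J <= n%:R :> R.
Hypothesis no_trap : forall x, inbox n x -> ~~ trapped (fun e => W e <= t) x.
Hypothesis few_bad : forall y, inbox (2 * n) y -> (nbad r (fun e => (W e <= t)%R) y <= 2 * d)%N.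
Hypothesis top_good : forall y, inbox (2 * n) y -> (nbad r (fun e => (W e <= g (2 ^+ J))%R) y < m)%N.
Hypothesis line_good : forall x j (a : 'I_(2 * r + 1)), inbox n x -> (j0 <= j < J)%N ->
  (line_count d r m (2 * n) a (fun e => (W e <= g (2 ^+ j))%R) x i0)%:R <= n%:R * (1 / 2) ^+ (3 * j) :> R.

Let bad j y := (m <= nbad r (fun e => (W e <= g (2 ^+ j))%R) y)%N.

Lemma line_bad_count x j : inbox n x -> (j0 <= j < J)%N ->
  \sum_(k < 2 * (2 * n) + 1) (bad j (set_coord x i0 ((k : nat)%:Z - (2 * n)%N%:Z)))%:R <=
  (2 * r + 1)%:R * (n%:R * (1 / 2) ^+ (3 * j)) :> R.
Proof.
move=> xn jj.
have rp : (0 < 2 * r + 1)%N by rewrite addn1.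
pose cls (k : 'I_(2 * (2 * n) + 1)) : 'I_(2 * r + 1) := Ordinal (ltn_pmod k rp).
rewrite (partition_big cls xpredT)//=.
have -> : (2 * r + 1)%:R * (n%:R * (1 / 2) ^+ (3 * j)) =
    \sum_(a < 2 * r + 1) (n%:R * (1 / 2) ^+ (3 * j)) :> R.
  by rewrite sumr_const card_ord mulr_natl.
apply: ler_sum => a _; apply: le_trans (line_good x j a xn jj).
rewrite -natr_sum ler_nat /line_count -sum1_card [X in (_ <= X)%N]big_mkcond/= big_mkcond/=.
apply: leq_sum => k _; rewrite inE -/(bad j _) -val_eqE/=.
by case: eqP => //= _; case: (bad _ _).
Qed.

(** The first term is the base level paid at each of at most [5 n] points of a line, the second the
    total of all higher levels. After multiplication by [n] they are [o(1 / g(n))] and a multiple of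
    [2^(-j0) / g(n)]. *)
Definition line_sum_bound : R :=
  5 * n%:R / g (2 ^+ j0) + 8 * (2 * r + 1)%:R / (c * 2 ^+ j0) / (n%:R * g n%:R).

(** Here [Z y] is [g] at the first level from [j0] on at which the ball of [y] has fewer than [m]
    bad edges; what has to be shown is the bound on the sum of [1 / Z] over each line. *)
Lemma good_scale_poincare (f : pt d -> R) : (forall x, ~ inbox n x -> f x = 0) ->
  \sum_(k : {ffun 'I_d -> 'I_(2 * n + 1)}) f (boxpt k) ^+ 2 <=
    (2 * (1 + (2 * d + 1) + 2 * (d * (2 * r)))%:R ^+ 2 * ((2 * r + 1) ^ d)%:R / t
     + 8 * (2 * (d * (2 * r))%:R) ^+ 2 * (2 * n + 1)%:R * ((2 * r + 1) ^ d)%:R * line_sum_bound)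
    * local_energy W n.+1 f 0.
Proof.
have p2 j : 0 < (2 : R) ^+ j by rewrite exprn_gt0.
have gp j : 0 < g (2 ^+ j) by exact: g_gt0.
have np : 0 < n%:R :> R by rewrite ltr0n; lia.
have gn : 0 < g n%:R by exact: g_gt0.
pose Q y := [pred j | (j0 <= j)%N && ~~ bad j y].
have ex_lev y : exists j, inbox (2 * n) y -> [/\ (j0 <= j <= J)%N, ~~ bad j y &
    forall i, (j0 <= i < j)%N -> bad i y].
  have [yn|] := pselect (inbox (2 * n) y); last by exists 0%N.
  have exQ : exists j, Q y j by exists J; rewrite /= jJ -ltnNge top_good.
  case: (ex_minnP exQ) => j /andP[jj nb] jmin; exists j => _; split=> //.
    by rewrite jj jmin//= jJ -ltnNge top_good.
  move=> i /andP[ji ij]; apply: contraLR ij => nbi; rewrite -leqNgt; apply: jmin.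
  by rewrite /= ji.
have [lev levP] := choice ex_lev.
pose Z y := g (2 ^+ lev y).
(* If the first good level exceeds [j0], the level just below it is bad, and its term in the sum is
   exactly [1 / Z y]. *)
have Zinv y : inbox (2 * n) y -> (Z y)^-1 <=
    (g (2 ^+ j0))^-1 + \sum_(j0 <= j < J) (g (2 ^+ j.+1))^-1 * (bad j y)%:R.
  move=> /levP[/andP[jl lJ] _ lb]; rewrite /Z.
  have pos j : 0 <= (g (2 ^+ j.+1))^-1 * (bad j y)%:R.
    by rewrite mulr_ge0 ?ler0n// invr_ge0 ltW.
  move: jl; rewrite leq_eqVlt => /predU1P[<-|jl].
    by rewrite lerDl sumr_ge0.
  rewrite -[X in X <= _]add0r lerD//; first by rewrite invr_ge0 ltW.
  case E : (lev y) jl lJ lb => [//|l] jl lJ lb.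
  rewrite (@big_cat_nat _ _ _ l j0 J)//=; last by exact: ltnW.
  rewrite (@big_ltn _ _ _ l J)//= lb ?mulr1; last by rewrite ltnSn andbT.
  by rewrite ler_wpDl ?sumr_ge0// ler_wpDr ?sumr_ge0.
apply: (@weighted_poincare R d W n r m t line_sum_bound Z i0 f) => //.
- by move=> x xn; have /allPn[[b a]] := no_trap x xn; rewrite mem_star/= -ltNge => ba tW;
    exists b, a; split=> //; case/orP: ba => /eqP; [left|right].
- move=> y yn; split; first exact: gp.
  by have [_ nb _] := levP y yn; rewrite ltnNge.
move=> x xn.
pose y (k : 'I_(2 * (2 * n) + 1)) : pt d := set_coord x i0 ((k : nat)%:Z - (2 * n)%N%:Z).
have yn k : inbox (2 * n) (y k).
  move=> j; rewrite mxE; case: eqP => _; first by have := ltn_ord k; lia.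
  by have := xn j; lia.
apply: le_trans (ler_sum _ (fun k _ => Zinv (y k) (yn k))) _.
rewrite big_split/= sumr_const card_ord exchange_big/=; apply: lerD.
  rewrite -[X in X <= _]mulr_natl ler_wpM2r ?invr_ge0 ?(ltW (gp j0))//.
  by rewrite -natrM ler_nat; lia.
(* At most [(2r + 1) n 2^(-3j)] points of the line are bad at level [j], and [decay] gives
   [1 / g(2^(j+1)) <= 4^(j+1) / (c n^2 g(n))]; the product decays like [2^(-j)]. *)
apply: (@le_trans _ _ (\sum_(j0 <= j < J)
    (4 * (2 * r + 1)%:R / (c * (n%:R * g n%:R))) * (1 / 2) ^+ j)).
  rewrite !big_nat; apply: ler_sum => j jj; rewrite -mulr_sumr.
  have [dec _] := decay.
  have jn : 2 ^+ j.+1 <= n%:R :> R.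
    by apply: le_trans Jn; rewrite ler_eXn2l ?ltr1n//; case/andP: jj.
  have uj : u0 <= 2 ^+ j.+1.
    by apply: le_trans u0j _; rewrite ler_eXn2l ?ltr1n// ltnW// ltnS; case/andP: jj.
  have := dec _ _ uj jn => h.
  apply: (@le_trans _ _ ((g (2 ^+ j.+1))^-1 * ((2 * r + 1)%:R * (n%:R * (1 / 2) ^+ (3 * j))))).
    by rewrite ler_wpM2l ?line_bad_count// invr_ge0 ltW.
  set D : R := (2 * r + 1)%:R; have D0 : 0 <= D by exact: ler0n.
  rewrite expr_half_cube exprS; rewrite (exprS 2 j) in h.
  move: (gp j.+1); rewrite exprS; move: (g (2 * 2 ^+ j)) h (p2 j) => G.
  have q0 : 0 <= (1 / 2) ^+ j :> R by rewrite exprn_ge0 ?half_ge0.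
  move: ((1 / 2) ^+ j) q0 (2 ^+ j) => q q0 y2 h y20 G0.
  have -> : G^-1 * (D * (n%:R * (q * (y2 ^+ 2)^-1))) =
      4 * D * q * (n%:R / (4 * y2 ^+ 2 * G)) by field; rewrite !gt_eqF// exprn_gt0.
  have -> : 4 * D / (c * (n%:R * g n%:R)) * q = 4 * D * q * (n%:R / (c * (n%:R ^+ 2 * g n%:R))).
    by field; rewrite !gt_eqF.
  rewrite ler_wpM2l ?mulr_ge0// ler_wpM2l ?ler0n// lef_pV2 ?posrE ?mulr_gt0 ?exprn_gt0//.
  by apply: le_trans h _; rewrite exprMn -natrX.
rewrite -mulr_sumr.
have := sum_half_geometric R j0 J; set s := \sum_(j0 <= j < J) _ => hs.
have K0 : 0 <= 4 * (2 * r + 1)%:R / (c * (n%:R * g n%:R)) :> R.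
  by rewrite divr_ge0 ?mulr_ge0 ?ler0n// ltW// mulr_gt0// mulr_gt0.
apply: le_trans (ler_wpM2l K0 hs) _; rewrite expr_half_nat le_eqVlt; apply/orP; left; apply/eqP.
by field; rewrite !gt_eqF.
Qed.

End GoodScale.

Lemma natr_side_le (R : realType) (n : nat) : (0 < n)%N -> (2 * n + 1)%:R <= 3 * n%:R :> R.
Proof. by move=> n0; rewrite -natrM ler_nat; lia. Qed.

Lemma big_shift (R : realType) (F : nat -> R) (a b : nat) :
  \sum_(a <= j < b) F j = \sum_(i < b - a) F (i + a)%N.
Proof. by rewrite -{1}[a]add0n big_addn big_mkord. Qed.

(** * Choice of constants and the almost sure conclusion *)

Section Assembly.
Variables (R : realType) (dd : measure_display) (T : measurableType dd)
  (P : probability T R) (d : nat) (w : edge d -> T -> R) (g : R -> R) (c u0 : R) (i0 : 'I_d).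
Hypothesis d2 : (2 <= d)%N.
Hypothesis iid : iid_env P w.
Hypothesis g_gt0 : forall u, 0 < u -> 0 < g u.
Hypothesis c_gt0 : 0 < c.
Hypothesis u0_gt0 : 0 < u0.
Hypothesis decay : speed_decay R g c u0.
Local Notation p := (pr R dd T P d w (0, i0)).
Hypothesis small : forall e, 0 < e -> exists2 M, 0 < M &
  forall u, M <= u -> u ^+ d * p (g u) ^+ (2 * d) <= e * ln (ln u).

Let p01 := pr01 R dd T P d w (0, i0) iid.
Let p_mono := le_pr R dd T P d w (0, i0) iid.
Local Notation N k := ((scale k)%:R : R).

Lemma prod_telescope (a b : nat) : (0 < a)%N ->
  \prod_(k <- iota a b) (k%:R / k.+1%:R) = a%:R / (a + b)%:R :> R.
Proof.
move=> a0; have -> : iota a b = index_iota a (a + b) by rewrite /index_iota addKn.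
elim: b => [|b IH]; first by rewrite addn0 big_geq// divff// pnatr_eq0 -lt0n.
rewrite addnS big_nat_recr ?leq_addr//= IH mulrA divfK// pnatr_eq0 -lt0n.
by rewrite (leq_trans a0)// leq_addr.
Qed.

Lemma blocks_without_trap (C : R) : 0 < C ->
  {ae P, forall om, forall a, exists2 k, (a <= k)%N &
     ~ has (trapped (fun e => w e om <= C * g (N k.+1))) (block d scale k)}.
Proof.
move=> C0.
have [k0 _ Hk0] := no_trap_bound R d p g c u0 d2 p01 p_mono g_gt0 c_gt0 u0_gt0 decay small C C0.
pose V k := [set om | has (trapped (fun e => w e om <= C * g (N k.+1))) (block d scale k)].
apply: (@ae_infinitely_often R dd T P V (maxn 1 k0)); first by rewrite leq_maxl.
move=> a b; rewrite geq_max => /andP[a0 ka].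
have [mB PB] := prob_blocks R dd T P d w (0, i0) iid scale (fun k => C * g (N k.+1)) leq_scale a b.
have -> : \bigcap_(k in [set k | (a <= k < a + b)%N]) V k =
    [set om | all (fun k => has (trapped (fun e => w e om <= C * g (N k.+1))) (block d scale k)) (iota a b)].
  apply/seteqP; split=> om /=; first by move=> H; apply/allP => k; rewrite mem_iota => /H.
  by move=> /allP H k /=; rewrite -mem_iota => /H.
split=> //; apply: le_trans PB _; rewrite lee_fin -prod_telescope//.
rewrite big_seq [X in _ <= X]big_seq; apply: ler_prod => k; rewrite mem_iota => /andP[ak _].
rewrite Hk0 ?andbT/=; last exact: leq_trans ka ak.
have /andP[q0 q1] := p01 (C * g (N k.+1)).
rewrite subr_ge0 exprn_ile1// ?subr_ge0 ?exprn_ile1// lerBlDr lerDl exprn_ge0//.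
Qed.

(** For [j < k.+1 ^ 2] the threshold is [n 2^(-3j)] with [n = scale k.+1], written as a natural
    number. *)
Definition line_event (m r k j : nat) : set T :=
  [set om | exists x : {ffun 'I_d -> 'I_(2 * scale k.+1 + 1)} * 'I_(2 * r + 1),
     (2 ^ (4 * k.+1 ^ 2 - 3 * j) < line_count d r m (2 * scale k.+1) x.2
        (fun e => (w e om <= g (2 ^+ j))%R) (boxpt x.1) i0)%N].

(** All that can go wrong at [scale k.+1] apart from a trapped vertex in [block k]. These failures
    stop almost surely, whereas blocks are free of trapped vertices only infinitely often. *)
Definition bad_event (C : R) (m r j0 k : nat) : set T :=
  [set om | exists x : {ffun 'I_d -> 'I_(2 * (scale k).+1 + 1)},
     trapped (fun e => w e om <= C * g (N k.+1)) (boxpt x)] `|`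
  [set om | exists x : {ffun 'I_d -> 'I_(2 * (2 * scale k.+1) + 1)},
     (2 * d + 1 <= nbad r (fun e => (w e om <= C * g (N k.+1))%R) (boxpt x))%N] `|`
  [set om | exists x : {ffun 'I_d -> 'I_(2 * (2 * scale k.+1) + 1)},
     (m <= nbad r (fun e => (w e om <= g (2 ^+ (k.+1 ^ 2)))%R) (boxpt x))%N] `|`
  \big[setU/set0]_(i < k.+1 ^ 2 - j0) line_event m r k (i + j0).

(** Each of the four pieces has probability at most [(1 / 2) ^+ k.+2], so the union has at most
    [(1 / 2) ^+ k]. *)
Lemma bad_event_rare (C : R) (r h j0 : nat) : 0 < C -> (4 * d + 4 <= h)%N ->
  (forall j, (j0 <= j)%N -> (2 ^ ((2 * r + 1) ^ d * d))%:R * p (g (2 ^+ j)) ^+ (2 * d * h) <=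
     (1 / 2) ^+ (3 * j) / 20) ->
  {ae P, forall om, exists K, forall k, (K <= k)%N -> ~ bad_event C (2 * d * h) r j0 k om}.
Proof.
move=> C0 dh j0P; set m := (2 * d * h)%N in j0P *.
set B : R := (2 ^ ((2 * r + 1) ^ d * d))%:R in j0P.
have B0 : 0 < B by rewrite ltr0n expn_gt0.
have D0 : 0 <= (2 * r + 1)%:R :> R by exact: ler0n.
have H1 := inner_bound R d p g c u0 d2 p01 p_mono g_gt0 c_gt0 u0_gt0 decay small C C0.
have H2 := level_bound R d p g c u0 d2 p01 p_mono g_gt0 c_gt0 u0_gt0 decay small C B C0 B0.
have H3 := top_bound R d p g d2 p01 small B h B0 dh.
have H4 := lines_bound R d p g d2 p01 B (2 * r + 1)%:R m j0 B0 D0 j0P.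
have := filterI (filterI H1 H2) (filterI H3 H4) => -[k0 _ Hk0].
have m1 k := prob_trap_box R dd T P d w (0, i0) iid (scale k).+1 (C * g (N k.+1)).
have m2 k := prob_ball_box R dd T P d w (0, i0) iid r (2 * d + 1) (2 * scale k.+1) (C * g (N k.+1)).
have m3 k := prob_ball_box R dd T P d w (0, i0) iid r m (2 * scale k.+1) (g (2 ^+ (k.+1 ^ 2))).
have m4 k j := prob_line_box R dd T P d w (0, i0) iid r m (scale k.+1) (2 * scale k.+1)
  (2 ^ (4 * k.+1 ^ 2 - 3 * j)) i0 (g (2 ^+ j)) (leq_pmull _ (ltn0Sn 1)).
pose A4 k i := line_event m r k (i + j0).
have mA4 k i : measurable (A4 k i) by case: (m4 k (i + j0)%N).
have mU4 k : measurable (\big[setU/set0]_(i < k.+1 ^ 2 - j0) A4 k i).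
  by apply: bigsetU_measurable => i _; exact: mA4.
apply: (@ae_eventually_not R dd T P _ k0) => [k|k kk].
  apply: measurableU => //; apply: measurableU; last by case: (m3 k).
  by apply: measurableU; [case: (m1 k)|case: (m2 k)].
have [[b1 b2] [b3 b4]] := Hk0 k kk.
have [[M1 P1] [M2 P2] [M3 P3]] := And3 (m1 k) (m2 k) (m3 k).
have P4 : (P (\big[setU/set0]_(i < k.+1 ^ 2 - j0) A4 k i) <= ((1 / 2) ^+ k.+2)%:E)%E.
  apply: le_trans (@Boole_inequality _ _ _ P (A4 k) (k.+1 ^ 2 - j0)%N _) _; first by move=> i _; exact: mA4.
  apply: (@le_trans _ _ (\sum_(i < k.+1 ^ 2 - j0) (((2 * scale k.+1 + 1) ^ d)%:R * (2 * r + 1)%:R *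
   ((1 + B * p (g (2 ^+ (i + j0))) ^+ m) ^+ (2 * (2 * scale k.+1) + 1) /
      2 ^+ (2 ^ (4 * k.+1 ^ 2 - 3 * (i + j0)))))%:E)%E).
    by apply: lee_sum => i _; rewrite -natrM; case: (m4 k (i + j0)%N).
  rewrite sumEFin lee_fin; apply: le_trans b4.
  by rewrite [X in _ <= X]big_shift.
have -> : (1 / 2) ^+ k = (1 / 2) ^+ k.+2 + (1 / 2) ^+ k.+2 + (1 / 2) ^+ k.+2 + (1 / 2) ^+ k.+2 :> R.
  by rewrite !exprS; move: ((1 / 2) ^+ k) => x; lra.
have M12 := measurableU _ _ M1 M2; have M123 := measurableU _ _ M12 M3.
rewrite !EFinD; apply: le_trans (measureU2 _ M123 (mU4 k)) _; apply: leeD; last exact: P4.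
apply: le_trans (measureU2 _ M12 M3) _; apply: leeD; last by apply: le_trans P3 _; rewrite lee_fin.
apply: le_trans (measureU2 _ M1 M2) _; apply: leeD; last by apply: le_trans P2 _; rewrite lee_fin.
by apply: le_trans P1 _; rewrite lee_fin.
Qed.

Lemma ltn_moment : (2 * d < 2 * d * (4 * d + 4))%N.
Proof using d2. by move: d2; clear; nia. Qed.

Lemma leq_succ_sqr k : (k <= k.+1 ^ 2)%N.
Proof using Type. by clear; nia. Qed.

Lemma leq_3_4 j k : (j < k)%N -> (3 * j <= 4 * k)%N.
Proof using Type. by clear; lia. Qed.

Lemma eigenvalue_often_large (tau : R) : 0 < tau ->
  {ae P, forall om, forall a, exists2 n, (a <= n)%N & tau <= lambda1 (w ^~ om) n / g n%:R}.
Proof.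
move=> tau0; have [_ Wp _ _] := iid; have [dec dec0] := decay.
pose h := (4 * d + 4)%N; pose m := (2 * d * h)%N; pose r := (2 * m + 1)%N.
pose B : R := (2 ^ ((2 * r + 1) ^ d * d))%:R.
pose Q1 : R := 2 * (1 + (2 * d + 1) + 2 * (d * (2 * r)))%:R ^+ 2 * ((2 * r + 1) ^ d)%:R.
pose Q2 : R := 8 * (2 * (d * (2 * r))%:R) ^+ 2 * ((2 * r + 1) ^ d)%:R.
have F0 : 0 < ((2 * r + 1) ^ d)%:R :> R by rewrite ltr0n expn_gt0 addn1.
have Q10 : 0 < Q1 by rewrite mulr_gt0// mulr_gt0// exprn_gt0// ltr0n.
have dr0 : 0 < (d * (2 * r))%:R :> R by rewrite ltr0n muln_gt0 (ltnW d2) /r addn1.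
have Q20 : 0 < Q2 by rewrite mulr_gt0// mulr_gt0// exprn_gt0// mulr_gt0.
pose D : R := (2 * r + 1)%:R.
have D0 : 0 < D by rewrite ltr0n addn1.
(* The goal is [2 tau g(n) Kc <= 1], reached as three contributions of at most 1/4. This [C] makes
   the local part exactly 1/4 ([E1]). *)
pose C := 8 * tau * Q1; have C0 : 0 < C by rewrite !mulr_gt0.
have [j1 Hj1] := prob_dyadic R d p g d2 p01 small.
(* The third condition absorbs the union constant [B] in [j0P]; the fourth brings the levels above
   [j0] down to 1/4 ([E4]). *)
have [j0 [u0j jj1 jB jD]] : exists j0, [/\ u0 <= 2 ^+ j0, (j1 <= j0)%N,
    20 * B <= 2 ^+ j0 & 6 * tau * Q2 * (8 * D) * 4 / c <= 2 ^+ j0].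
  have := filterI (filterI (near_le_pow2 R u0) (nbhs_infty_ge j1))
    (filterI (near_le_pow2 R (20 * B)) (near_le_pow2 R (6 * tau * Q2 * (8 * D) * 4 / c))).
  by move=> [j0 _ /(_ j0 (leqnn _)) [[? ?] [? ?]]]; exists j0.
have j0P j : (j0 <= j)%N -> B * p (g (2 ^+ j)) ^+ m <= (1 / 2) ^+ (3 * j) / 20.
  move=> j0j; have hj := Hj1 j (leq_trans jj1 j0j).
  have pj : 0 <= p (g (2 ^+ j)) by case/andP: (p01 (g (2 ^+ j))).
  have B0 : 0 < B by rewrite ltr0n expn_gt0.
  have h4 : p (g (2 ^+ j)) ^+ m <= (1 / 2) ^+ (4 * j).
    rewrite /m exprM [X in _ <= X](_ : _ = ((1 / 2) ^+ j) ^+ 4); last by rewrite -exprM mulnC.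
    apply: (@le_trans _ _ (((1 / 2) ^+ j) ^+ h)).
      by rewrite lerXn2r ?nnegrE ?exprn_ge0 ?half_ge0.
    by rewrite ler_wiXn2l ?exprn_ge0 ?exprn_ile1 ?half_ge0 ?half_le1// leq_addl.
  apply: le_trans (ler_wpM2l (ltW B0) h4) _.
  rewrite (_ : 4 * j = j + 3 * j)%N; last by rewrite -mulSn.
  rewrite exprD mulrA mulrC ler_wpM2l ?exprn_ge0 ?half_ge0//.
  rewrite expr_half_nat ler_pdivrMr ?exprn_gt0// -ler_pdivrMl ?invr_gt0// invrK.
  by apply: le_trans jB _; rewrite ler_eXn2l ?ltr1n.
have gj0 : 0 < g (2 ^+ j0) by rewrite g_gt0 ?exprn_gt0.
have Q120 : 0 < 6 * 5 * 4 * tau * Q2 by rewrite !mulr_gt0.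
(* With [j0] fixed, [n^2 g(n)] small against [g(2^j0)] brings the base level down to 1/4 ([E3]). *)
have [M M0 HM] := dec0 (g (2 ^+ j0) / (6 * 5 * 4 * tau * Q2)) (divr_gt0 gj0 Q120).
have often := blocks_without_trap C C0.
have rare := bad_event_rare C r h j0 C0 (leqnn _) j0P.
apply: filterS2 often rare => om often_om [K rare_om] a.
have [k1 _ Hk1] := near_succ _ (near_ge_scale R (Num.max M (r + 2)%:R)).
have [k kk noblock] := often_om (maxn (maxn a K) (maxn k1 j0)).
move: kk; rewrite !geq_max => /andP[/andP[ak Kk] /andP[k1k j0k]].
have := rare_om k Kk; rewrite /bad_event => nbad_k.
pose n := scale k.+1.
have := Hk1 k k1k; rewrite ge_max => /andP[Mn rn].
exists n; first by rewrite (leq_trans ak)// (leq_trans (leqnSn k))// leq_id_scale.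
have np : 0 < n%:R :> R by rewrite ltr0n scale_gt0.
have gn : 0 < g n%:R by exact: g_gt0.
have t0 : 0 < C * g n%:R by rewrite mulr_gt0.
have jJ : (j0 <= k.+1 ^ 2)%N by exact: leq_trans j0k (leq_succ_sqr k).
have poin := @good_scale_poincare R d g c u0 (w ^~ om) i0 m n j0 (k.+1 ^ 2) (C * g n%:R) d2
  g_gt0 c_gt0 decay (fun e => Wp e om) t0.
pose S := line_sum_bound R g c m n j0.
pose Kc := Q1 / (C * g n%:R) + Q2 * (2 * n + 1)%:R * S.
have S0 : 0 < S.
  rewrite /S /line_sum_bound addr_gt0//; first by rewrite divr_gt0// mulr_gt0.
  apply: divr_gt0; last exact: mulr_gt0.
  by apply: divr_gt0; rewrite mulr_gt0// exprn_gt0.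
have Kc0 : 0 < Kc by rewrite addr_gt0 ?divr_gt0// !mulr_gt0// ltr0n addn1.
have lam : (2 * Kc)^-1 <= lambda1 (w ^~ om) n.
  apply: lambda1_ge => // f f0; rewrite /Kc.
  have -> : Q2 * (2 * n + 1)%:R * S = 8 * (2 * (d * (2 * r))%:R) ^+ 2 * (2 * n + 1)%:R *
      ((2 * r + 1) ^ d)%:R * S by rewrite /Q2; ring.
  apply: poin => //.
  - exact: ltn_moment.
  - by move: rn; rewrite ler_nat.
  - by rewrite /n scaleR ler_eXn2l ?ltr1n// leq_pmull.
  (* A trapped vertex is either in the enlarged inner box, excluded at all large scales, or in the
     annulus [block k], excluded at this scale. *)
  - move=> x xn; apply/negP => trap.
    have [xin|xout] := pselect (inbox (scale k).+1 x).
      by apply: nbad_k; left; left; left; have [y yE] := inbox_ex d _ _ xin; exists y; rewrite -yE.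
    by apply: noblock; apply/hasP; exists x => //; exact: annulus_mem.
  - move=> y yn; rewrite leqNgt; apply/negP => nb; apply: nbad_k; left; left; right.
    by have [x xE] := inbox_ex d _ _ yn; exists x; rewrite -xE addn1.
  - move=> y yn; rewrite ltnNge; apply/negP => nb; apply: nbad_k; left; right.
    by have [x xE] := inbox_ex d _ _ yn; exists x; rewrite -xE.
  - move=> x j cl xn /andP[jj jk].
    have -> : n%:R * (1 / 2) ^+ (3 * j) = (2 ^ (4 * k.+1 ^ 2 - 3 * j))%:R :> R.
      by rewrite natrX expr2B ?expr_half_nat ?scaleR// leq_3_4.
    rewrite ler_nat leqNgt; apply/negP => lc; apply: nbad_k; right.
    rewrite -(bigcup_mkord _ (fun i => line_event m r k (i + j0))); exists (j - j0)%N => /=; first by rewrite ltn_sub2r// (leq_ltn_trans jj).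
    rewrite subnK//; have [y yE] := inbox_ex d _ _ xn.
    by exists (y, cl); rewrite /= -yE.
rewrite ler_pdivlMr//; apply: le_trans lam.
rewrite -[X in _ <= X]div1r ler_pdivlMr ?mulr_gt0//.
have E1 : tau * g n%:R * (2 * (Q1 / (C * g n%:R))) = 1 / 4.
  by rewrite /C; field; rewrite !gt_eqF.
have n3 : (2 * n + 1)%:R <= 3 * n%:R :> R by exact: natr_side_le (scale_gt0 _).
have E2 : tau * g n%:R * (2 * (Q2 * (3 * n%:R) * S)) =
    6 * 5 * tau * Q2 / g (2 ^+ j0) * (n%:R ^+ 2 * g n%:R) + 6 * tau * Q2 * (8 * D) / c / 2 ^+ j0.
  by rewrite /S /line_sum_bound -/r -/D; field; rewrite !gt_eqF ?exprn_gt0.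
have E3 : 6 * 5 * tau * Q2 / g (2 ^+ j0) * (n%:R ^+ 2 * g n%:R) <= 1 / 4.
  have -> : 1 / 4 = 6 * 5 * tau * Q2 / g (2 ^+ j0) * (g (2 ^+ j0) / (6 * 5 * 4 * tau * Q2)).
    by field; rewrite !gt_eqF.
  by rewrite ler_wpM2l ?HM// divr_ge0 ?(ltW gj0)// !mulr_ge0// ltW.
have E4 : 6 * tau * Q2 * (8 * D) / c / 2 ^+ j0 <= 1 / 4.
  by rewrite ler_pdivrMr ?exprn_gt0//; move: jD; rewrite mulrAC; lra.
have E5 : tau * g n%:R * (2 * (Q2 * (2 * n + 1)%:R * S)) <= tau * g n%:R * (2 * (Q2 * (3 * n%:R) * S)).
  rewrite ler_pM2l ?mulr_gt0// ler_pM2l// ler_wpM2r ?(ltW S0)// ler_wpM2l// ltW//.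
rewrite /Kc mulrDr mulrDr E1; move: E5; rewrite E2.
move: E3 E4; move: (_ * (n%:R ^+ 2 * _)) (_ / 2 ^+ j0) (tau * _ * (2 * _)) => x1 x2 x3; lra.
Qed.

End Assembly.

Lemma limn_esup_pinfty (R : realType) (u : nat -> R) :
  (forall (M a : nat), exists2 n, (a <= n)%N & M%:R <= u n) ->
  limn_esup (fun n => (u n)%:E) = +oo%E.
Proof.
move=> H; apply/eqP; rewrite -leye_eq; apply: le_ereal_inf_tmp => _ [A [a _ Aa] <-].
rewrite leye_eq; apply/eqP/eqyP => M M0.
have [n an un] := H (Num.truncn M).+1 a.
apply: (@le_trans _ _ (u n)%:E).
  by rewrite lee_fin (le_trans _ un)// ltW// truncnS_gt.
by apply: ereal_sup_ubound; exists n => //; exact: Aa.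
Qed.

Lemma small_of_cvg (R : realType) (h : R -> R) :
  h u / ln (ln u) @[u --> +oo] --> (0 : R) ->
  forall e, 0 < e -> exists2 M, 0 < M & forall u, M <= u -> h u <= e * ln (ln u).
Proof.
move=> H e e0; have [M M0 HM] := cvgy_le R _ _ e H e0.
(* Beyond [expR 2] one has [ln u >= 2], hence [ln (ln u) > 0], and the quotient can be cleared. *)
exists (Num.max M (expR 2)); first by rewrite lt_max M0.
move=> u; rewrite ge_max => /andP[Mu eu]; have := HM u Mu.
have up : 0 < u by exact: lt_le_trans M0 Mu.
have l2 : 2 <= ln u by rewrite -(expRK 2) ler_ln ?posrE ?expR_gt0.
by rewrite ler_pdivrMr// ln_gt0//; lra.
Qed.

Theorem theorem1p1 (R : realType) (dd : measure_display) (T : measurableType dd)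
    (P : probability T R) (d : nat) (w : edge d -> T -> R) (g : R -> R)
    (d2 : (2 <= d)%N) :
  iid_env P w ->
  (forall u, 0 < u -> 0 < g u) ->
  mono_to_zero g ->
  ((exists rho : R, rho < -2 /\ reg_var g rho) \/
   mono_to_zero (fun u => u ^+ 2 * g u)) ->
  (Lambda P w (Ordinal (leq_trans (isT : (0 < 2)%N) d2)) g u / ln (ln u))
      @[u --> +oo] --> (0 : R) ->
  {ae P, forall om,
     limn_esup (fun n : nat => ((lambda1 (w ^~ om) n) / g n%:R)%:E) = +oo%E}.
Proof.
move=> iid g_gt0 [g_mono _] growth LambdaP.
have [c [u0 [c0 u00 decay]]] := speed_decay_of R g g_gt0 growth g_mono.
have small := small_of_cvg R _ LambdaP.
set i0 := Ordinal _ in small.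
have large M := eigenvalue_often_large R dd T P d w g c u0 i0 d2 iid g_gt0 c0 u00 decay small
  M.+1%:R (ltr0Sn R M).
apply: filterS (ae_foralln large) => om H; apply: limn_esup_pinfty => M a.
by have [n an Mn] := H M a; exists n => //; apply: le_trans Mn; rewrite ler_nat.
Qed.
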